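(* $\bigoplus\mathbf{L}\subseteq\mathbf{BQ1P}$.
   Context: For $w\ge1$ let $\mathcal{A}_w$ be the algebra of $2^w\times 2^w$ complex matrices acting on $w$ qubits; $X_j,Z_j$ are the Pauli operators on qubit $j$. Gate alphabet: $G_w\subset\mathcal{A}_w$ consists of the identity, all CNot gates $\frac12(1+Z_j+X_k-Z_jX_k)$ with $j\ne k$, all Hadamard gates $\frac{1}{\sqrt2}(X_j+Z_j)$, and all gates $\exp(iZ_j\pi/8)$. DQC1 circuits: a DQC1 circuit of width $w$ with $n$ classical input bits is a finite list of triples $(i,A,B)$ with $1\le i\le n$ and $A,B\in G_w$. On classical input $x\in\{0,1\}^n$ each triple contributes the unitary $A$ if $x_i=0$ and $B$ if $x_i=1$; the product of the selected unitaries, in the order listed, is a unitary $V(x)\in\mathcal{A}_w$. The circuit is applied to the starting state $\rho_{\mathrm{start}}=(1+Z_1)/2^w$, giving $V(x)\rho_{\mathrm{start}}V(x)^\dagger$, and the first qubit is measured in the computational basis; the probability of outcome $0$ is $(1+\beta(x))/2$, where the output bias is $\beta(x)=\mathrm{Tr}[V(x)Z_1V(x)^\dagger Z_1]/2^w$, a real number. A family $(C_n)_n$ of circuits ($C_n$ having $n$ classical input bits) is uniform if a deterministic logspace Turing machine outputs the description of $C_n$ on input $1^n$; widths and sizes are then polynomially bounded. $\mathbf{BQ1P}$: a language $\mathcal{L}\subseteq\{0,1\}^*$ is in $\mathbf{BQ1P}$ if there are a uniform family $(C_n)_n$ of DQC1 circuits and a polynomially bounded positive function $q$ such that, with $\beta(x)$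 the output bias of $C_{|x|}$ on input $x$, every $x\in\mathcal{L}$ has $\beta(x)\ge 1/q(|x|)$ and every $x\notin\mathcal{L}$ has $\beta(x)\le -1/q(|x|)$. $\bigoplus\mathbf{L}$: the class of languages $\mathcal{L}$ for which there is a uniform (logspace describable) family of circuits $(D_n)_n$, where $D_n$ is a list of CNot gates on $w_n$ qubits, each gate possibly being additionally controlled by a classical bit of the input string $x\in\{0,1\}^n$ (the gate being applied or omitted according to the value of that bit), such that when $D_{|x|}$ with control string $x$ is applied to the pure state $|100\ldots00\rangle$, the resulting computational basis state has first qubit $|0\rangle$ if and only if $x\in\mathcal{L}$.
   Formalization: In BQ1P the bias conditions are required only for nonempty x: a DQC1 circuit with n = 0 input bits has no gates, so its output bias is always 1 and the literal inclusion fails for languages in ⊕L not containing the empty word. *)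

(* Defs.v *)
From HB Require Import structures.
From mathcomp Require Import all_boot all_order all_algebra.
From mathcomp Require Import complex.
From mathcomp Require Import all_classical all_reals all_analysis.

Set Implicit Arguments.
Unset Strict Implicit.
Unset Printing Implicit Defensive.

Import Order.TTheory GRing.Theory Num.Theory.
Import numFieldNormedType.Exports.

Local Open Scope classical_set_scope.
Local Open Scope ring_scope.
Local Open Scope complex_scope.

Inductive dir := Lft | Stay | Rgt.

(* The read-only input tape holds the input word between two end markers. *)
Inductive cell := LeftEnd | RightEnd | Bit of bool.

(* Read-only two-way input tape, finitely many (indexed by tm_tape) read/write
   one-way infinite work tapes, write-only one-way output tape.  The transition
   function maps the current state and the scanned symbols to None (halt), or
   to a new state, a move of the input head, a symbol to write and a move for
   each work tape, and possibly one symbol to append to the output. *)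
Record transducer (Sigma : finType) := Transducer {
  tm_state : finType;
  tm_tape : finType;
  tm_symb : finType;
  tm_blank : tm_symb;
  tm_start : tm_state;
  tm_delta : tm_state -> cell -> {ffun tm_tape -> tm_symb} ->
    option (tm_state * dir * {ffun tm_tape -> tm_symb * dir} * option Sigma)
}.

(* A work tape is a finite word, continued by blanks, and a head position;
   cell 0 is the leftmost one. *)
Record config (Sigma : finType) (M : transducer Sigma) := Config {
  cf_state : tm_state M;
  cf_head : nat;
  cf_work : {ffun tm_tape M -> seq (tm_symb M) * nat};
  cf_out : seq Sigma
}.

Definition move (d : dir) (p : nat) : nat :=
  match d with Lft => p.-1 | Stay => p | Rgt => p.+1 end.

Definition read_input (x : seq bool) (p : nat) : cell :=
  if p is p'.+1 then (if onth x p' is Some b then Bit b else RightEnd)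
  else LeftEnd.

Section Run.
Variables (Sigma : finType) (M : transducer Sigma) (x : seq bool).

Definition init_config : config M :=
  Config (tm_start M) 0 [ffun=> ([::], 0%N)] [::].

(* None when M halts in configuration c. *)
Definition step (c : config M) : option (config M) :=
  let scanned :=
    [ffun k => nth (tm_blank M) (cf_work c k).1 (cf_work c k).2] in
  if tm_delta (cf_state c) (read_input x (cf_head c)) scanned
       is Some (q, d, act, o) then
    Some (Config q (minn (move d (cf_head c)) (size x).+1)
      [ffun k => let: (s, p) := cf_work c k in
         (set_nth (tm_blank M) s p (act k).1, move (act k).2 p)]
      (if o is Some a then rcons (cf_out c) a else cf_out c))
  else None.

Definition config_at (t : nat) : option (config M) :=
  iter t (obind step) (Some init_config).

Definition outputs (y : seq Sigma) : Prop :=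
  exists t c, [/\ config_at t = Some c, step c = None & cf_out c = y].

(* Heads start on cell 0 and move by at most one cell at a time, so this says
   that at most s cells of each work tape are ever visited. *)
Definition in_space (s : nat) : Prop :=
  forall t c, config_at t = Some c -> forall k, ((cf_work c k).2 < s)%N.

End Run.

(* Only the unary inputs 1^n are ever supplied to the machine. *)
Definition logspace (Sigma : finType) (M : transducer Sigma) : Prop :=
  exists c : nat,
    forall n, in_space M (nseq n true) (c * (trunc_log 2 n).+1)%N.

Definition uniform (Sigma : finType) (T : nat -> Type)
    (describe : forall n, T n -> seq Sigma) (C : forall n, T n) : Prop :=
  exists M : transducer Sigma, logspace M /\
    forall n, outputs M (nseq n true) (describe n (C n)).

(* A CNot gate, as the pair (control, target). *)
Definition cnot (w : nat) := {jk : 'I_w * 'I_w | jk.1 != jk.2}.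

(* The alphabet G_w; GPhase j stands for exp(i Z_j pi / 8). *)
Inductive gate (w : nat) :=
  GId | GCNot of cnot w | GHad of 'I_w | GPhase of 'I_w.

Record dqc1_circuit (n : nat) := DQC1Circuit {
  dqc1_width : nat;
  dqc1_width_gt0 : (0 < dqc1_width)%N;
  dqc1_gates : seq ('I_n * gate dqc1_width * gate dqc1_width)
}.

(* A control Some (i, b) means that the gate is applied iff x_i = b. *)
Record cnot_circuit (n : nat) := CNotCircuit {
  cnot_width : nat;
  cnot_width_gt0 : (0 < cnot_width)%N;
  cnot_gates : seq (option ('I_n * bool) * cnot cnot_width)
}.

Inductive token :=
  TMark | TStop | TId | TCNot | THad | TPhase | TFree | TPos | TNeg.

Definition nat_of_token (a : token) : 'I_9 :=
  inord match a with
  | TMark => 0 | TStop => 1 | TId => 2 | TCNot => 3 | THad => 4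
  | TPhase => 5 | TFree => 6 | TPos => 7 | TNeg => 8 end.

Definition token_of_nat (m : 'I_9) : token :=
  nth TMark [:: TMark; TStop; TId; TCNot; THad; TPhase; TFree; TPos; TNeg] m.

Lemma nat_of_tokenK : cancel nat_of_token token_of_nat.
Proof. by case; rewrite /token_of_nat inordK. Qed.

HB.instance Definition _ := Finite.copy token (can_type nat_of_tokenK).

(* Numbers are described in unary, so that a family produced in logarithmic
   space has polynomially bounded widths; in binary it might not. *)
Definition describe_nat (k : nat) : seq token := rcons (nseq k TMark) TStop.

Definition describe_cnot w (g : cnot w) : seq token :=
  describe_nat (val g).1 ++ describe_nat (val g).2.

Definition describe_gate w (g : gate w) : seq token :=
  match g with
  | GId => [:: TId]
  | GCNot c => TCNot :: describe_cnot c
  | GHad j => THad :: describe_nat j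
  | GPhase j => TPhase :: describe_nat j
  end.

Definition describe_triple n w (t : 'I_n * gate w * gate w) : seq token :=
  let: (i, A, B) := t in
  describe_nat i ++ describe_gate A ++ describe_gate B.

Definition describe_dqc1 n (C : dqc1_circuit n) : seq token :=
  describe_nat (dqc1_width C) ++
  flatten [seq describe_triple t | t <- dqc1_gates C].

Definition describe_control n (c : option ('I_n * bool)) : seq token :=
  if c is Some (i, b) then (if b then TPos else TNeg) :: describe_nat i
  else [:: TFree].

Definition describe_cnot_circuit n (D : cnot_circuit n) : seq token :=
  describe_nat (cnot_width D) ++
  flatten [seq describe_control t.1 ++ describe_cnot t.2 | t <- cnot_gates D].

Definition bits (w : nat) := {ffun 'I_w -> bool}.

Lemma card_bits w : #|{: bits w}| = (2 ^ w)%N.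
Proof. by rewrite card_ffun card_bool card_ord. Qed.

(* A labelling of the rows and columns of 2^w x 2^w matrices by the
   computational basis states; which one is chosen is immaterial. *)
Definition index_of w (b : bits w) : 'I_(2 ^ w) :=
  cast_ord (card_bits w) (enum_rank b).

Definition bits_of w (s : 'I_(2 ^ w)) : bits w :=
  enum_val (cast_ord (esym (card_bits w)) s).

Definition flip w (j : 'I_w) (b : bits w) : bits w :=
  [ffun k => b k (+) (k == j)].

Section Operators.
Variable R : realType.

Definition op (w : nat) := 'M[R[i]]_(2 ^ w).

Definition ket w (b : bits w) : 'cV[R[i]]_(2 ^ w) := delta_mx (index_of b) 0.

Definition pauliX w (j : 'I_w) : op w :=
  \matrix_(s, t) (bits_of s == flip j (bits_of t))%:R.

Definition pauliZ w (j : 'I_w) : op w :=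
  \matrix_(s, t) ((-1) ^+ bits_of s j *+ (s == t)).

Definition adjoint w (A : op w) : op w := (A ^t*)%sesqui.

(* The matrix exponential, as its power series. *)
Definition exp_mx m (A : 'M[R[i]]_m) : 'M[R[i]]_m :=
  \matrix_(s, t)
    let term k := (k`!%:R^-1 *: A ^+ k) s t in
    lim (series (fun k => complex.Re (term k)) @ \oo) +i*
    lim (series (fun k => complex.Im (term k)) @ \oo).

Definition cnot_mx w (g : cnot w) : op w :=
  let: (j, k) := val g in
  2^-1 *: (1 + pauliZ j + pauliX k - pauliZ j * pauliX k).

Definition gate_mx w (g : gate w) : op w :=
  match g with
  | GId => 1
  | GCNot c => cnot_mx c
  | GHad j => (Num.sqrt 2)^-1%:C *: (pauliX j + pauliZ j)
  | GPhase j => exp_mx (('i%C * (pi / 8)%:C) *: pauliZ j)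
  end.

Definition dqc1_unitary n (C : dqc1_circuit n) (x : n.-tuple bool) :
    op (dqc1_width C) :=
  \prod_(t <- dqc1_gates C)
    let: (i, A, B) := t in gate_mx (if tnth x i then B else A).

Definition output_bias n (C : dqc1_circuit n) (x : n.-tuple bool) : R[i] :=
  let V := dqc1_unitary C x in
  let Z1 := pauliZ (Ordinal (dqc1_width_gt0 C)) in
  \tr (V * Z1 * adjoint V * Z1) / (2 ^ dqc1_width C)%:R.

Definition poly_bounded (q : nat -> R) : Prop :=
  exists p : {poly R}, forall n, q n <= p.[n%:R].

(* In R[i], u <= v means that v - u is a nonnegative real.
   The empty word is exempted: a circuit without input bits has no gates
   (every gate refers to an input bit), so its bias is always 1. *)
Definition BQ1P : set (set (seq bool)) :=
  [set L | exists (C : forall n, dqc1_circuit n) (q : nat -> R),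
    [/\ uniform describe_dqc1 C, poly_bounded q, forall n, 0 < q n &
      forall x : seq bool, x <> [::] ->
        let beta := output_bias (C (size x)) (in_tuple x) in
        (L x -> (1 / q (size x))%:C <= beta) /\
        (~ L x -> beta <= - (1 / q (size x))%:C)]].

Definition control_on n (x : n.-tuple bool) (c : option ('I_n * bool)) : bool :=
  if c is Some (i, b) then tnth x i == b else true.

Definition cnot_start n (D : cnot_circuit n) : bits (cnot_width D) :=
  [ffun j => j == Ordinal (cnot_width_gt0 D)].

(* The gates act in the order listed. *)
Definition cnot_final n (D : cnot_circuit n) (x : n.-tuple bool) :
    'cV[R[i]]_(2 ^ cnot_width D) :=
  foldl (fun v t => if control_on x t.1 then cnot_mx t.2 *m v else v)
    (ket (cnot_start D)) (cnot_gates D).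

Definition ParityL : set (set (seq bool)) :=
  [set L | exists D : forall n, cnot_circuit n,
    uniform describe_cnot_circuit D /\
    forall x : seq bool,
      L x <-> exists b : bits (cnot_width (D (size x))),
        cnot_final (D (size x)) (in_tuple x) = ket b /\
        b (Ordinal (cnot_width_gt0 (D (size x)))) = false].

End Operators.

(* Main.v *)
(* On an input x, a CNot circuit acts as a unitary W which permutes the basis
   states linearly over F_2; let b be the image of 10...0. Then
   W X_1 W^-1 = X^b, and X^b Z_1 X^b = (-1)^(b_1) Z_1. Since exp(i Z pi/8)^4 is
   i Z, the matrix i X_1 is available as H T^4 H, and V = W (i X_1) W^-1 has
   output bias exactly (-1)^(b_1). As the first gate listed is the leftmost
   factor of V, the list for V is the CNot list reversed, then H T^4 H, then the
   CNot list.

   A two-way finite transducer can write this list while reading the description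
   of the CNot circuit. It is composed with the logspace machine M producing that
   description by storing its position in binary and running M anew for each
   symbol. The position needs O(log n) bits because M, which halts, never
   repeats a configuration. *)
From HB Require Import structures.
Require Import Defs.
From mathcomp Require Import all_boot all_order all_algebra.
From mathcomp Require Import complex.
From mathcomp Require Import all_classical all_reals all_analysis.
From mathcomp Require Import zify ring.

Set Implicit Arguments.
Unset Strict Implicit.
Unset Printing Implicit Defensive.

Import Order.TTheory GRing.Theory Num.Theory.
Import numFieldNormedType.Exports.

(** * Runs of transducers *)

(** The model shapes the construction in three ways. A left move on cell 0 of a work tape is
    silently ignored and no symbol marks that cell. The composite machine therefore records which
    cells it has visited and flags the leftmost one itself; otherwise it could neither erase the
    tapes before a new run nor bring its heads home. The machine is never told a space bound. Its
    counter gains a cell only on overflow, and the length of the counter is bounded afterwards,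
    through the number of symbols that a halting run can write. Runs carry their head bound with
    them, so that output and space come out of the same induction. Every DQC1 triple must name an
    input bit. Gates that do not depend on the input are attached to the first bit with the same
    gate on both sides, so an uncontrolled CNot has to be written twice. On inputs of length 0 no
    triple exists, and only the width is copied; hence the start state of the two-way transducer
    depends on whether the input is empty. *)

(* Configurations up to their output, with tapes as functions: writing a blank
   beyond the end of a word then leaves the tape equal to itself. *)
Record core (Sigma : finType) (M : transducer Sigma) := Core {
  co_state : tm_state M;
  co_head : nat;
  co_cell : tm_tape M -> nat -> tm_symb M;
  co_pos : tm_tape M -> nat
}.

Definition olist T (o : option T) : seq T := if o is Some a then [:: a] else [::].

Section Cores.
Variables (Sigma : finType) (M : transducer Sigma) (x : seq bool).

Definition core0 : core M :=
  Core (tm_start M) 0 (fun _ _ => tm_blank M) (fun _ => 0).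

Definition scan (c : core M) : {ffun tm_tape M -> tm_symb M} :=
  [ffun k => co_cell c k (co_pos c k)].

Definition act_core (c : core M) (q : tm_state M) (d : dir)
    (act : {ffun tm_tape M -> tm_symb M * dir}) : core M :=
  Core q (minn (move d (co_head c)) (size x).+1)
    (fun k i => if i == co_pos c k then (act k).1 else co_cell c k i)
    (fun k => move (act k).2 (co_pos c k)).

Definition cstep (c : core M) : option (core M * option Sigma) :=
  if tm_delta (co_state c) (read_input x (co_head c)) (scan c)
       is Some (q, d, act, o) then Some (act_core c q d act, o)
  else None.

Definition core_of (c : config M) : core M :=
  Core (cf_state c) (cf_head c) (fun k => nth (tm_blank M) (cf_work c k).1)
    (fun k => (cf_work c k).2).

Lemma core_of_init : core_of (init_config M) = core0.
Proof.
by rewrite /core_of /core0 /=; congr Core;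
  apply/funext => k; rewrite ffunE //=; apply/funext => i; rewrite nth_nil.
Qed.

Lemma step_core_of (c : config M) :
  match cstep (core_of c) with
  | None => step x c = None
  | Some (d, o) => exists2 c', step x c = Some c' &
      core_of c' = d /\ cf_out c' = cf_out c ++ olist o
  end.
Proof.
rewrite /cstep /step /= -/(scan (core_of c)).
case: tm_delta => [[[[q d] act] o]|] //=; eexists; first by [].
split; last by case: o => //= [a|]; rewrite ?cats1 ?cats0.
by rewrite /core_of /act_core /=; congr Core; apply/funext => k;
  rewrite ffunE; case: (cf_work c k) => s p //=; apply/funext => i;
  rewrite nth_set_nth.
Qed.

(** The head bound is demanded of each core that is left, not of the last one. Runs then concatenate
    freely, and the bound for the last core is supplied where the machine halts. *)
Inductive reach (s : nat) : core M -> seq Sigma -> core M -> Prop :=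
| reach0 c : reach s c [::] c
| reachS c d e o w : (forall k, co_pos c k < s) -> cstep c = Some (d, o) ->
    reach s d w e -> reach s c (olist o ++ w) e.

Lemma reach_trans s c d e v w :
  reach s c v d -> reach s d w e -> reach s c (v ++ w) e.
Proof.
elim=> // {}c {}d f o {}v hs hc _ IH /IH he.
by rewrite -catA; apply: reachS hc he.
Qed.

Lemma reach_trans0 s c d e w :
  reach s d w e -> reach s c [::] d -> reach s c w e.
Proof. by move=> h1 h2; apply: reach_trans h2 h1. Qed.

Lemma reach_step s c d o : (forall k, co_pos c k < s) ->
  cstep c = Some (d, o) -> reach s c (olist o) d.
Proof. by move=> hs hc; rewrite -[olist o]cats0; apply: reachS hc (reach0 _ _). Qed.

Lemma config_atS t :
  config_at M x t.+1 = obind (step x) (config_at M x t).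
Proof. by []. Qed.

(** By determinism the configurations of the machine are those of the run. After halting [config_at]
    stays [None], so the space bound at later times is vacuous. *)
Lemma reach_config_at s c w d : reach s c w d ->
  forall t cf, config_at M x t = Some cf -> core_of cf = c ->
  (forall k, co_pos d k < s) -> cstep d = None ->
  (exists t' cf', [/\ config_at M x t' = Some cf', step x cf' = None &
     cf_out cf' = cf_out cf ++ w]) /\
  (forall t' cf', t <= t' -> config_at M x t' = Some cf' ->
     forall k, (cf_work cf' k).2 < s).
Proof.
elim=> {c w d} [c|c d e o w hs hc _ IH] t cf ht hcf hd hn.
  have := step_core_of cf; rewrite hcf hn => hcn.
  split; first by exists t, cf; rewrite cats0.
  move=> t' cf' tt'.
  case: (leqP t' t) => [t't|].
    have -> : t' = t by apply/eqP; rewrite eqn_leq t't tt'.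
    by rewrite ht => -[<-] k; have := hd k; rewrite -hcf.
  move=> /subnK <-.
  have -> // : config_at M x (t' - t.+1 + t.+1) = None.
  elim: (t' - _) => [|m IHm]; first by rewrite add0n config_atS ht.
  by rewrite addSn config_atS IHm.
have := step_core_of cf; rewrite hcf hc => -[c' hc' [hd' ho]].
have ht' : config_at M x t.+1 = Some c' by rewrite config_atS ht.
have [[t1 [cf1 [h1 h2 h3]]] h4] := IH _ _ ht' hd' hd hn.
split; first by exists t1, cf1; rewrite catA -ho.
move=> t' cf'; rewrite leq_eqVlt => /orP[/eqP <-|]; last exact: h4.
by rewrite ht => -[<-] k; have := hs k; rewrite -hcf.
Qed.

Lemma reach_outputs s w d : reach s core0 w d ->
  (forall k, co_pos d k < s) -> cstep d = None ->
  outputs M x w /\ in_space M x s.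
Proof.
move=> hr hd hn; have := reach_config_at hr (erefl _ : config_at M x 0 = _).
move=> /(_ core_of_init hd hn) [[t [c [h1 h2 h3]]] h4]; split.
  by exists t, c; split.
by move=> t' c' ht; apply: (h4 t' c').
Qed.

Lemma config_at_reach s t c : in_space M x s ->
  config_at M x t = Some c -> reach s core0 (cf_out c) (core_of c).
Proof.
move=> hs; elim: t c => [|t IH] c.
  by move=> [<-]; rewrite core_of_init; apply: reach0.
rewrite config_atS; case ht : config_at => [c1|] //= hc.
have := step_core_of c1; case hc1 : cstep => [[d o]|]; last by rewrite hc.
rewrite hc => -[_ [<-] [hd ->]]; apply: reach_trans (IH _ ht) _.
by rewrite hd; apply: reach_step hc1 => k; apply: hs ht k.
Qed.

Lemma size_config_at t c : config_at M x t = Some c -> size (cf_out c) <= t.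
Proof.
elim: t c => [|t IH] c; first by move=> [<-].
rewrite config_atS; case ht : config_at => [c1|] //= hc.
have := step_core_of c1; case hc1 : cstep => [[d o]|]; last by rewrite hc.
rewrite hc => -[_ [<-] [_ ->]]; rewrite size_cat.
by have := IH _ ht; case: o hc1 => [a|] _ /=; lia.
Qed.

(** A core has tapes that are functions on all of [nat], so it cannot be counted directly. Its
    fingerprint lives in a finite type and determines it as long as the core is [small]. *)
Definition fingerprint s (c : core M) :
    tm_state M * 'I_(size x).+2 *
      {ffun tm_tape M -> {ffun 'I_s.+1 -> tm_symb M} * 'I_s.+1} :=
  (co_state c, inord (co_head c),
   [ffun k => ([ffun i : 'I_s.+1 => co_cell c k i], inord (co_pos c k))]).

(** One cell more than [in_space] grants: this form is preserved by a step from a core whose heads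
    are below [s], before anything is known about the heads of the next core. *)
Definition small s (c : core M) :=
  [/\ co_head c < (size x).+2, forall k, co_pos c k < s.+1 &
      forall k i, s < i -> co_cell c k i = tm_blank M].

Lemma fingerprint_inj s c d : small s c -> small s d ->
  fingerprint s c = fingerprint s d -> c = d.
Proof.
case: c d => [q h f p] [q' h' f' p'] [/= hh hp hf] [/= hh' hp' hf'].
case=> -> /(congr1 (@nat_of_ord _)); rewrite !inordK // => -> /ffunP hw.
congr Core; apply/funext => k; last first.
  have := hw k; rewrite !ffunE => -[_ /(congr1 (@nat_of_ord _))].
  by rewrite !inordK.
apply/funext => i; case: (leqP i s) => hi; last by rewrite hf ?hf'.
have := hw k; rewrite !ffunE => -[/ffunP/(_ (inord i))] + _.
by rewrite !ffunE /= inordK.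
Qed.

Lemma reach_small s c w d : reach s c w d -> small s c ->
  (forall k, co_pos d k < s) -> small s d.
Proof.
elim=> // {c w d} c d e o w hs hc _ IH [h1 h2 h3] he; apply: IH => //.
move: hc; rewrite /cstep; case: tm_delta => [[[[q m] act] o']|] // [<- _].
split=> /= [|k|k i hi].
- by rewrite ltnS geq_minr.
- by have := hs k; case: (act k).2 => /=; lia.
- by case: eqP => [hi'|]; [have := hs k; lia|rewrite h3].
Qed.

(** The cardinality of the type of fingerprints. *)
Definition config_bound s :=
  #|tm_state M| * (size x).+2 * (#|tm_symb M| ^ s.+1 * s.+1) ^ #|tm_tape M|.

(** If the cores at times i < j agreed, they would agree ever after, since the output does not
    influence a step; the machine would then be stuck at a time when it is still running. So the
    cores up to halting are distinct, and there are at most as many as fingerprints. *)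
Lemma halting_time s t c : in_space M x s -> config_at M x t = Some c ->
  step x c = None -> t < config_bound s.
Proof.
move=> hs ht hn.
have hex i : i <= t -> exists ci, config_at M x i = Some ci.
  move=> hi; case h : (config_at M x i) => [ci|]; first by exists ci.
  have hN m : config_at M x (m + i) = None.
    by elim: m => [|m IH]; rewrite ?add0n // addSn config_atS IH.
  by move: ht; rewrite -(subnK hi) hN.
pose cf (i : 'I_t.+1) : config M := odflt (init_config M) (config_at M x i).
have cfE (i : 'I_t.+1) : config_at M x i = Some (cf i).
  by rewrite /cf; have [ci ->] := hex i (ltn_ord i).
have hinj : injective (fun i => core_of (cf i)).
  suff lt_neq (i j : 'I_t.+1) : i < j -> core_of (cf i) <> core_of (cf j).
    move=> i j hij; case: (ltngtP i j) => [/lt_neq /(_ hij) []|/lt_neq|/val_inj //].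
    by move=> /(_ (esym hij)).
  move=> hij heq.
  have loop m : j + m <= t -> exists c1 c2,
     [/\ config_at M x (i + m) = Some c1, config_at M x (j + m) = Some c2 &
         core_of c1 = core_of c2].
    elim: m => [|m IH] hm; first by exists (cf i), (cf j); rewrite !addn0 -!cfE; split.
    have [|c1 [c2 [h1 h2 h12]]] := IH; first by lia.
    have [c2' hc2'] := hex _ hm.
    move: hc2'; rewrite addnS config_atS h2 /= => hc2'.
    have := step_core_of c2; have := step_core_of c1; rewrite -h12.
    case: cstep => [[d o]|]; last by rewrite hc2'.
    move=> [c1' hc1' [hd1 _]] [c3 hc3 [hd3 _]].
    exists c1', c3; rewrite !addnS !config_atS h1 ?h2 /= hc1' hc3.
    by rewrite hd1 hd3.
  have hj : j + (t - j) = t by rewrite subnKC // -ltnS.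
  have [|c1 [c2 [h1 h2 h12]]] := loop (t - j); first by rewrite hj.
  move: h2; rewrite hj ht => -[hc2].
  have := step_core_of c1; have := step_core_of c.
  rewrite h12 -hc2; case: cstep => [[d o]|]; first by rewrite hn => -[].
  (* Time [i + (t - j)] lies before [t], so a next configuration exists there, although the core is
     the halted one. *)
  move=> _ hc1; have [|c3] := hex (i + (t - j)).+1; first by lia.
  by rewrite config_atS h1 /= hc1.
have hsm i : small s (core_of (cf i)).
  apply: reach_small (config_at_reach hs (cfE i)) _ _; first by split.
  by move=> k; apply: hs (cfE i) k.
have finj : injective (fun i => fingerprint s (core_of (cf i))).
  by move=> i j /fingerprint_inj; move/(_ (hsm i) (hsm j))/hinj.
have := leq_card _ finj.
rewrite card_ord !card_prod card_ffun card_prod card_ffun !card_ord.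
by [].
Qed.

Lemma outputs_reach s y : in_space M x s -> outputs M x y ->
  exists d, [/\ reach s core0 y d, forall k, co_pos d k < s,
    cstep d = None & size y < config_bound s].
Proof.
move=> hs [t [c [ht hn <-]]]; exists (core_of c); split.
- exact: config_at_reach ht.
- by move=> k; apply: hs ht k.
- have := step_core_of c; case: cstep => [[d o]|] //.
  by rewrite hn => -[].
- exact: leq_ltn_trans (size_config_at ht) (halting_time hs ht hn).
Qed.

End Cores.

(** * Composition with a two-way finite transducer *)

Section Bits.

Definition bit (q i : nat) : bool := odd (q %/ 2 ^ i).

(** The divisibility says that the borrow has run through the [j] low zeros of [q]. Writing q = m
    2^j with m odd gives q - 1 = (m - 1) 2^j + (2^j - 1), from which each range of bits is read
    off. *)
Lemma bit_pred q j : 2 ^ j %| q -> bit q j ->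
  forall i, bit q.-1 i = if i < j then true else if i == j then false else bit q i.
Proof.
rewrite /bit => /dvdnP[m ->]; rewrite mulnK ?expn_gt0 // => om i.
have m0 : 0 < m by case: m om.
have e : (m * 2 ^ j).-1 = m.-1 * 2 ^ j + (2 ^ j).-1.
  by have := expn_gt0 2 j; case: m m0 {om} => // m _; rewrite mulSn /=; lia.
case: ltngtP => [ij|ji|->].
- have -> : (m * 2 ^ j).-1 = (m * 2 ^ (j - i)).-1 * 2 ^ i + (2 ^ i).-1.
    rewrite -{1}(subnK (ltnW ij)) expnD mulnA.
    have := expn_gt0 2 i; have : 0 < m * 2 ^ (j - i) by rewrite muln_gt0 m0 expn_gt0.
    by case: (m * _) => // u _; rewrite mulSn /=; lia.
  rewrite divnMDl ?expn_gt0 // divn_small ?addn0 ?prednK ?expn_gt0 //.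
  have : ~~ odd (m * 2 ^ (j - i)).
    by rewrite oddM oddX orbF subn_eq0 leqNgt ij andbF.
  have : 0 < m * 2 ^ (j - i) by rewrite muln_gt0 m0 expn_gt0.
  by move: (m * 2 ^ (j - i)) => [|u] //= _; rewrite negbK => ->.
- rewrite -(subnKC ji) addSn -addnS expnD !divnMA mulnK ?expn_gt0 //.
  rewrite e divnMDl ?expn_gt0 // [(2 ^ j).-1 %/ _]divn_small ?prednK ?expn_gt0 //.
  rewrite addn0 expnS !divnMA !divn2.
  by case: m om {m0 e} => //= m om; rewrite uphalf_half (negbTE om).
- rewrite e divnMDl ?expn_gt0 // divn_small ?addn0 ?prednK ?expn_gt0 //.
  by case: m om {m0 e} => //= m /negbTE.
Qed.

Lemma bit_dvd q j : 2 ^ j %| q -> ~~ bit q j -> 2 ^ j.+1 %| q.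
Proof.
move=> /dvdnP[m ->]; rewrite /bit mulnK ?expn_gt0 // => om.
by rewrite mulnC expnSr dvdn_pmul2l ?expn_gt0 // dvdn2.
Qed.

Lemma bit_dvdF q j i : 2 ^ j %| q -> i < j -> bit q i = false.
Proof.
move=> /dvdnP[m ->] ij; rewrite /bit -(subnK (ltnW ij)) expnD mulnA.
by rewrite mulnK ?expn_gt0 // oddM oddX orbF subn_eq0 leqNgt ij andbF.
Qed.

(** Here the divisibility says that the [j] low bits of [p] are ones. Bit [j] of p + 1 is set, as
    otherwise [p] would end in j + 1 ones; then [bit_pred] is read backwards. *)
Lemma bit_succ p j : 2 ^ j %| p.+1 -> bit p j = false ->
  forall i, bit p.+1 i = if i < j then false else if i == j then true else bit p i.
Proof.
move=> hd hb i.
have hb' : bit p.+1 j.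
  apply/negPn/negP => /(bit_dvd hd)/dvdnP[m hm].
  move: hb; rewrite -[p]/(p.+1.-1) hm /bit.
  have -> : (m * 2 ^ j.+1).-1 = (m * 2).-1 * 2 ^ j + (2 ^ j).-1.
    have := expn_gt0 2 j; move: hm; rewrite expnS mulnA.
    by case: m => [|m _] //; rewrite mulSn !addSn mulSn /=; lia.
  rewrite divnMDl ?expn_gt0 // divn_small ?addn0 ?prednK ?expn_gt0 //.
  by case: m hm => [|m] // _; rewrite mulSn /= muln2 odd_double.
have := bit_pred hd hb' i => /=.
by case: ltngtP => [/(bit_dvdF hd)||->].
Qed.

Lemma bit_dvdS p j : 2 ^ j %| p.+1 -> bit p j -> 2 ^ j.+1 %| p.+1.
Proof.
move=> hd hb; apply: bit_dvd => //; apply/negP => hb'.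
by have := bit_pred hd hb' j; rewrite /= hb ltnn eqxx.
Qed.

End Bits.

(* To advance the two-way transducer T by one step, PRewind moves every work
   head past the visited cells and the input head home; PErase sweeps back,
   clearing the tapes of M and setting the countdown to the position of T; PSim
   runs M, and PDec and PRet decrement the countdown at each symbol it writes.
   An underflow (PFound) means that this symbol is the one scanned by T. Then
   PEmit writes what T writes, and PInc or PDecr updates the position. *)
Inductive phase :=
  PStart | PProbe | PRewind | PErase | PDec | PRet | PFound | PEmit | PInc |
  PDecr | PSim.

Definition phases :=
  [:: PStart; PProbe; PRewind; PErase; PDec; PRet; PFound; PEmit; PInc;
      PDecr; PSim].

Definition nat_of_phase (a : phase) : 'I_11 :=
  inord match a with
  | PStart => 0 | PProbe => 1 | PRewind => 2 | PErase => 3 | PDec => 4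
  | PRet => 5 | PFound => 6 | PEmit => 7 | PInc => 8 | PDecr => 9
  | PSim => 10 end.

Definition phase_of_nat (m : 'I_11) : phase := nth PStart phases m.

Lemma nat_of_phaseK : cancel nat_of_phase phase_of_nat.
Proof. by case; rewrite /phase_of_nat inordK. Qed.

HB.instance Definition _ := Finite.copy phase (can_type nat_of_phaseK).

(* None is the left end marker, Some None the right one. *)
Definition mark (T : Type) := option (option T).

Definition read_mark T (y : seq T) (p : nat) : mark T :=
  if p is p'.+1 then Some (onth y p') else None.

(** The argument of [tw_start] tells whether the input of the composite machine is empty, which the
    tape [y] of the transducer need not show. *)
Record twoway (Sigma Delta : finType) := TwoWay {
  tw_state : finType;
  tw_start : bool -> tw_state;
  tw_delta : tw_state -> mark Sigma -> option (tw_state * dir * seq Delta)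
}.

(** Being inductive, this describes halting runs only. The side conditions keep the position between
    the two end markers: decrementing it never underflows, and its binary length is controlled by
    [size y]. *)
Inductive trun (Sigma Delta : finType) (T : twoway Sigma Delta) (y : seq Sigma) :
    tw_state T -> nat -> seq Delta -> Prop :=
| trun_halt q p : tw_delta q (read_mark y p) = None -> trun y q p [::]
| trun_move q p q' d v z :
    tw_delta q (read_mark y p) = Some (q', d, v) ->
    (d = Lft -> 0 < p) -> move d p <= (size y).+1 ->
    trun y q' (move d p) z -> trun y q p (v ++ z).

Section Compose.
Variables (Sigma Delta : finType) (M : transducer Sigma) (T : twoway Sigma Delta).

(** Makes the index of the next symbol to emit fit into the finite state. *)
Definition out_bound : nat :=
  \max_(qa : tw_state T * mark Sigma)
    size (oapp snd [::] (tw_delta qa.1 qa.2)).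

(* (is this the leftmost cell, simulated symbol, position bit, countdown bit);
   None is an unvisited cell. *)
Definition csymb : Type := option (bool * tm_symb M * bool * bool).

Definition cflag (u : csymb) := if u is Some (f, _, _, _) then f else false.
Definition csim (u : csymb) := if u is Some (_, g, _, _) then g else tm_blank M.
Definition cleft : csymb := Some (true, tm_blank M, false, false).
Definition ccopy (u : csymb) : csymb := omap (fun v => (v.1, v.1.2)) u.

Definition cstate : Type :=
  (phase * tw_state T * tm_state M * mark Sigma * 'I_out_bound.+1)%type.

Definition ctape : Type := option (tm_tape M).

(* The extra tape None holds the position of T, and a countdown. *)
Definition ctl (w : {ffun ctape -> csymb}) (u : csymb * dir) :
    {ffun ctape -> csymb * dir} :=
  [ffun j => if j is Some _ then (w j, Stay) else u].

(** [PErase] hands over to [PDec], not to [PSim]: one unit is taken off the countdown before M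
    starts, and stands for the left end marker, which occupies position 0. If M halts before the
    countdown underflows, the scanned cell is the right end marker [Some None]. *)
Definition cdelta (st : cstate) (inp : cell) (w : {ffun ctape -> csymb}) :
    option (cstate * dir * {ffun ctape -> csymb * dir} * option Delta) :=
  let: (ph, q, s, a, k) := st in
  let keep := ctl w (w None, Stay) in
  match ph with
  | PStart => Some ((PProbe, q, s, a, k), Rgt, [ffun=> (cleft, Stay)], None)
  | PProbe =>
    Some ((PRewind, tw_start T (if inp is Bit _ then false else true), s, a, k),
          Lft, keep, None)
  | PRewind =>
    if (if inp is LeftEnd then true else false) && [forall j, w j == None]
    then Some ((PErase, q, s, a, k), Stay, keep, None)
    else Some ((PRewind, q, s, a, k), Lft,
               [ffun j => (w j, if w j is Some _ then Rgt else Stay)], None)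
  | PErase =>
    Some ((if [forall j, cflag (w j)] then (PDec, q, tm_start M, None, k)
           else (PErase, q, s, a, k)), Stay,
      [ffun j => if j is Some _
        then (if cflag (w j) then (cleft, Stay) else (None, Lft))
        else (ccopy (w j), if cflag (w j) then Stay else Lft)], None)
  | PDec =>
    if w None is Some (f, g, b, c) then
      if c then
        Some ((PRet, q, s, a, k), Stay, ctl w (Some (f, g, b, false), Stay), None)
      else
        Some ((PDec, q, s, a, k), Stay, ctl w (Some (f, g, b, true), Rgt), None)
    else Some ((PFound, q, s, a, k), Stay, ctl w (None, Lft), None)
  | PRet =>
    if cflag (w None) then Some ((PSim, q, s, a, k), Stay, keep, None)
    else Some ((PRet, q, s, a, k), Stay, ctl w (w None, Lft), None)
  | PFound =>
    if cflag (w None) then Some ((PEmit, q, s, a, ord0), Stay, keep, None)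
    else Some ((PFound, q, s, a, k), Stay, ctl w (w None, Lft), None)
  | PSim =>
    if tm_delta s inp [ffun j => csim (w (Some j))] is Some (s', d, act, o)
    then
      Some ((if o is Some b then PDec else PSim, q, s',
             if o is Some b then Some (Some b) else a, k), d,
        [ffun j => if j is Some i
          then (Some (cflag (w j), (act i).1, false, false), (act i).2)
          else (w j, Stay)], None)
    else Some ((PEmit, q, s, Some None, ord0), Stay, keep, None)
  | PEmit =>
    if tw_delta q a is Some (q', d, v) then
      if onth v k is Some b then
        Some ((PEmit, q, s, a, inord k.+1), Stay, keep, Some b)
      else
        Some ((match d with Lft => PDecr | Stay => PRewind | Rgt => PInc end,
               q', s, a, k), Stay, keep, None)
    else None
  | PInc =>
    if w None is Some (f, g, b, c) then
      if b then
        Some ((PInc, q, s, a, k), Stay, ctl w (Some (f, g, false, c), Rgt), None)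
      else
        Some ((PRewind, q, s, a, k), Stay, ctl w (Some (f, g, true, c), Stay), None)
    else Some ((PRewind, q, s, a, k), Stay,
               ctl w (Some (false, tm_blank M, true, false), Stay), None)
  | PDecr =>
    if w None is Some (f, g, b, c) then
      if b then
        Some ((PRewind, q, s, a, k), Stay, ctl w (Some (f, g, false, c), Stay), None)
      else
        Some ((PDecr, q, s, a, k), Stay, ctl w (Some (f, g, true, c), Rgt), None)
    else Some ((PRewind, q, s, a, k), Stay, keep, None)
  end.

Definition compose : transducer Delta :=
  @Transducer Delta cstate ctape csymb None
    (PStart, tw_start T true, tm_start M, None, ord0) cdelta.

End Compose.

Section ComposeRun.
Variables (Sigma Delta : finType) (M : transducer Sigma) (T : twoway Sigma Delta).
Variables (x : seq bool) (s S : nat) (y : seq Sigma).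
Notation C := (compose M T).
Notation symb := (csymb M).
Notation ccore := (core C).

Definition joint (st : cstate M T) (h : nat) (cm : tm_tape M -> nat -> symb)
    (pm : tm_tape M -> nat) (cc : nat -> symb) (pc : nat) : ccore :=
  @Core _ C st h (fun j => if j is Some t then cm t else cc)
    (fun j => if j is Some t then pm t else pc).

Definition update A (f : nat -> A) p u i : A := if i == p then u else f i.

Lemma update_id A (f : nat -> A) p : update f p (f p) = f.
Proof. by apply/funext => i; rewrite /update; case: eqP => [->|]. Qed.

Lemma eq_joint st h cm pm cc pc st' h' cm' pm' cc' pc' :
  st = st' -> h = h' -> cm = cm' -> pm = pm' -> cc = cc' -> pc = pc' ->
  joint st h cm pm cc pc = joint st' h' cm' pm' cc' pc'.
Proof. by do 6!move->. Qed.

Lemma ctl_step st st' h cm pm cc pc u d o : h <= (size x).+1 ->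
  let c := joint st h cm pm cc pc in
  cdelta st (read_input x h) (scan c) = Some (st', Stay, ctl (scan c) (u, d), o) ->
  cstep x c = Some (joint st' h cm pm (update cc pc u) (move d pc), o).
Proof.
move=> hh c; rewrite /cstep /= => ->; congr (Some (_, _)).
rewrite /act_core /joint /=; congr Core; first by apply/minn_idPl.
  by apply/funext => -[t|]; apply/funext => i; rewrite /update !ffunE //=; case: eqP => [->|].
by apply/funext => -[t|]; rewrite !ffunE.
Qed.

Lemma scanN st h cm pm cc pc : scan (joint st h cm pm cc pc) None = cc pc.
Proof. by rewrite ffunE. Qed.

Lemma joint_pos st h cm pm cc pc : (forall t, pm t < S) -> pc < S ->
  forall k, co_pos (joint st h cm pm cc pc) k < S.
Proof. by move=> h1 h2 [t|]; [apply: h1|]. Qed.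

Definition oflag (u : symb) : option bool := omap (fun v => v.1.1.1) u.

(** A tape with [l] visited cells: simulated symbols [F], position bits [P], countdown bits [Q].
    [encC] is the counter tape and [encM] a tape of M. *)
Definition enc (F : nat -> tm_symb M) (P Q : nat -> bool) (l i : nat) : symb :=
  if i < l then Some (i == 0, F i, P i, Q i) else None.

Definition encC := enc (fun _ => tm_blank M).
Definition encM F := enc F (fun _ => false) (fun _ => false).

Definition visited (c : nat -> symb) (l : nat) : Prop :=
  0 < l /\ forall i, oflag (c i) = if i < l then Some (i == 0) else None.

Lemma visited_enc F P Q l : 0 < l -> visited (enc F P Q l) l.
Proof. by move=> l0; split=> // i; rewrite /enc; case: ifP. Qed.

Lemma cflagE u : cflag u = (oflag u == Some true).
Proof. by case: u => [[[[[] ?] ?] ?]|]. Qed.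

(** * Arithmetic on the counter tape *)

Section Counter.
Variables (q : tw_state T) (r : tm_state M) (a : mark Sigma).
Variables (k : 'I_(out_bound T).+1) (h : nat).
Variables (cm : tm_tape M -> nat -> symb) (pm : tm_tape M -> nat).
Variable L : nat.
Hypothesis hh : h <= (size x).+1.
Hypothesis pmS : forall t, pm t < S.
Hypothesis LS : L < S.

Notation "ph @ cc $ pc" := (joint (ph, q, r, a, k) h cm pm cc pc)
  (at level 60, cc at level 59, pc at level 59).

Lemma ctl_reach ph ph' cc pc cc' pc' u d k' :
  pc < S ->
  (let c := ph @ cc $ pc in
  cdelta (ph, q, r, a, k) (read_input x h) (scan c) =
    Some ((ph', q, r, a, k'), Stay, ctl (scan c) (u, d), None)) ->
  update cc pc u = cc' -> move d pc = pc' ->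
  reach x S (ph @ cc $ pc) [::] (joint (ph', q, r, a, k') h cm pm cc' pc').
Proof.
move=> hpc hd <- <-; have := ctl_step hh hd.
by apply: reach_step; apply: joint_pos.
Qed.

Lemma keep_reach ph ph' cc pc d k' :
  pc < S ->
  (let c := ph @ cc $ pc in
  cdelta (ph, q, r, a, k) (read_input x h) (scan c) =
    Some ((ph', q, r, a, k'), Stay, ctl (scan c) (cc pc, d), None)) ->
  reach x S (ph @ cc $ pc) [::] (joint (ph', q, r, a, k') h cm pm cc (move d pc)).
Proof. by move=> hpc hd; apply: ctl_reach hpc hd _ _ => //; apply: update_id. Qed.

Lemma ret_reach P Q j : j < L ->
  reach x S (PRet @ encC P Q L $ j) [::] (PSim @ encC P Q L $ 0).
Proof.
elim: j => [|j IH] jL.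
  apply: (keep_reach (d := Stay)) => /=; first by lia.
  by rewrite scanN /encC /enc jL.
refine (reach_trans0 (IH (ltnW jL)) _).
apply: (keep_reach (d := Lft)) => /=; first by lia.
by rewrite scanN /encC /enc jL.
Qed.

Lemma found_reach P Q j : j < L ->
  reach x S (PFound @ encC P Q L $ j) [::]
    (joint (PEmit, q, r, a, ord0) h cm pm (encC P Q L) 0).
Proof.
elim: j => [|j IH] jL.
  apply: (keep_reach (d := Stay)) => /=; first by lia.
  by rewrite scanN /encC /enc jL.
refine (reach_trans0 (IH (ltnW jL)) _).
apply: (keep_reach (d := Lft)) => /=; first by lia.
by rewrite scanN /encC /enc jL.
Qed.

(** The borrow has reached cell [j], and the zeros below it have become ones. If it runs off the
    end, then 2^L divides p < 2^L, so p = 0; this is the underflow. *)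
Lemma dec_sweep P p j : p < 2 ^ L -> j <= L -> 2 ^ j %| p ->
  let c := PDec @ encC P (fun i => if i < j then true else bit p i) L $ j in
  if p == 0 then
    exists Q, reach x S c [::] (PFound @ encC P Q L $ L.-1)
  else exists2 j', j' < L & reach x S c [::] (PRet @ encC P (bit p.-1) L $ j').
Proof.
move=> pL jL; have [n hn] := ubnP (L - j); elim: n j jL hn => // n IH j jL hn dj /=.
move: jL; rewrite leq_eqVlt => /predU1P[jL|jL].
  have p0 : p = 0.
    by move: dj pL; rewrite jL; case: (posnP p) => // p0 /(dvdn_leq p0); lia.
  rewrite p0 eqxx; eexists; rewrite jL.
  apply: (keep_reach (d := Lft)) => //=.
  by rewrite scanN /encC /enc ltnn.
case bj : (bit p j).
  case: eqP => [p0|/eqP p0]; first by move: bj; rewrite p0 /bit div0n.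
  exists j => //; apply: (@ctl_reach _ _ _ _ _ _
    (Some (j == 0, tm_blank M, P j, false)) Stay) => //=.
  - by lia.
  - by rewrite scanN /encC /enc jL ltnn bj.
  - apply/funext => i; rewrite /update /encC /enc (bit_pred dj bj).
    by case: eqP => [->|]; rewrite ?jL ?ltnn.
have := IH j.+1 jL _ (bit_dvd dj (negbT bj)).
have -> : L - j.+1 < n by lia.
move=> /(_ isT) /=.
have h1 : reach x S (PDec @ encC P (fun i => if i < j then true else bit p i) L $ j) [::]
   (PDec @ encC P (fun i => if i < j.+1 then true else bit p i) L $ j.+1).
  apply: (@ctl_reach _ _ _ _ _ _ (Some (j == 0, tm_blank M, P j, true)) Rgt) => //=.
  - by lia.
  - by rewrite scanN /encC /enc jL ltnn bj.
  - apply/funext => i; rewrite /update /encC /enc.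
    by case: eqP => [->|]; rewrite ?jL ?ltnS ?leqnn // => ij;
  rewrite [i <= j]leq_eqVlt (introF eqP ij).
case: eqP => _ [u].
  by move=> h2; exists u; exact: reach_trans0 h2 h1.
by move=> uL h2; exists u => //; exact: reach_trans0 h2 h1.
Qed.

Lemma dec_reach P p : 0 < L -> p < 2 ^ L ->
  let c := PDec @ encC P (bit p) L $ 0 in
  if p is p'.+1 then reach x S c [::] (PSim @ encC P (bit p') L $ 0)
  else exists Q, reach x S c [::] (joint (PEmit, q, r, a, ord0) h cm pm (encC P Q L) 0).
Proof.
move=> L0 pL; have := @dec_sweep P p 0 pL (leq0n _) (dvd1n _).
case: p pL => [|p] pL /= [u].
  move=> h1; exists u; refine (reach_trans0 _ h1).
  by apply: found_reach; rewrite prednK.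
by move=> uL h1; exact: reach_trans0 (ret_reach _ _ uL) h1.
Qed.

(** The same sweep on the position bits. The head is left where the borrow stops, as [PRewind] moves
    it anyway. *)
Lemma move_decr Q p j : 0 < p -> p < 2 ^ L -> j <= L -> 2 ^ j %| p ->
  exists2 j', j' <= L &
  reach x S (PDecr @ encC (fun i => if i < j then true else bit p i) Q L $ j)
    [::] (PRewind @ encC (bit p.-1) Q L $ j').
Proof.
move=> p0 pL jL; have [n hn] := ubnP (L - j); elim: n j jL hn => // n IH j jL hn dj /=.
move: jL; rewrite leq_eqVlt => /predU1P[jL|jL].
  by move: dj pL; rewrite jL => /(dvdn_leq p0); lia.
case bj : (bit p j).
  exists j; first exact: ltnW.
  apply: (@ctl_reach _ _ _ _ _ _ (Some (j == 0, tm_blank M, false, Q j)) Stay) => //=.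
  - by lia.
  - by rewrite scanN /encC /enc jL ltnn bj.
  - apply/funext => i; rewrite /update /encC /enc (bit_pred dj bj).
    by case: eqP => [->|]; rewrite ?jL ?ltnn.
have [|j' j'L h2] := IH j.+1 jL _ (bit_dvd dj (negbT bj)); first by lia.
exists j' => //; refine (reach_trans0 h2 _).
apply: (@ctl_reach _ _ _ _ _ _ (Some (j == 0, tm_blank M, true, Q j)) Rgt) => //=.
- by lia.
- by rewrite scanN /encC /enc jL ltnn bj.
- apply/funext => i; rewrite /update /encC /enc.
  by case: eqP => [->|]; rewrite ?jL ?ltnS ?leqnn // => ij;
  rewrite [i <= j]leq_eqVlt (introF eqP ij).
Qed.

(** The tape grows only when p + 1 is exactly 2^L. This is what later ties the number of counter
    cells to the largest position. *)
Lemma move_incr Q p j : 0 < L -> p < 2 ^ L -> j <= L -> 2 ^ j %| p.+1 ->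
  exists Q' j' L', [/\ j' <= L', p.+1 < 2 ^ L',
    L' = L \/ L' = L.+1 /\ p.+1 = 2 ^ L &
  reach x S (PInc @ encC (fun i => if i < j then false else bit p i) Q L $ j)
    [::] (PRewind @ encC (bit p.+1) Q' L' $ j')].
Proof.
move=> L0 pL jL; have [n hn] := ubnP (L - j); elim: n j jL hn => // n IH j jL hn dj /=.
move: jL; rewrite leq_eqVlt => /predU1P[jL|jL].
  have eL : p.+1 = 2 ^ L.
    by apply/eqP; rewrite eqn_leq pL -jL dvdn_leq.
  have bL : bit p L = false by rewrite /bit divn_small.
  (* The carry ran off the end and created cell [L], whose countdown bit is written as [false]. *)
  exists (update Q L false), L, L.+1; rewrite leqnSn; split=> //.
  - by rewrite eL ltn_exp2l.
  - by right.
  apply: (@ctl_reach _ _ _ _ _ _ (Some (false, tm_blank M, true, false)) Stay) => //=.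
  - by rewrite jL.
  - by rewrite scanN /encC /enc jL ltnn.
  - apply/funext => i; rewrite /update /encC /enc (@bit_succ p L) -?eL // jL.
    case: ltngtP => [iL|iL|->].
    + by rewrite (ltn_trans iL).
    + by rewrite ltnS leqNgt iL.
    + by rewrite ltnSn (gtn_eqF L0).
case bj : (bit p j); last first.
  exists Q, j, L; rewrite ltnW //; split=> //.
  - rewrite ltn_neqAle pL andbT; apply/eqP => eL.
    have := bit_succ dj bj j; rewrite ltnn eqxx.
    by rewrite (@bit_dvdF _ L) ?eL ?dvdnn.
  - by left.
  apply: (@ctl_reach _ _ _ _ _ _ (Some (j == 0, tm_blank M, true, Q j)) Stay) => //=.
  - by lia.
  - by rewrite scanN /encC /enc jL ltnn bj.
  - apply/funext => i; rewrite /update /encC /enc (bit_succ dj bj).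
    by case: eqP => [->|]; rewrite ?jL ?ltnn.
have [|Q' [j' [L' [h1 h2 h3 h4]]]] := IH j.+1 jL _ (bit_dvdS dj bj); first by lia.
exists Q', j', L'; split=> //; refine (reach_trans0 h4 _).
apply: (@ctl_reach _ _ _ _ _ _ (Some (j == 0, tm_blank M, false, Q j)) Rgt) => //=.
- by lia.
- by rewrite scanN /encC /enc jL ltnn bj.
- apply/funext => i; rewrite /update /encC /enc.
  by case: eqP => [->|]; rewrite ?jL ?ltnS ?leqnn // => ij;
  rewrite [i <= j]leq_eqVlt (introF eqP ij).
Qed.

End Counter.

Lemma joint_step st h cm pm cc pc st' d act o :
  let c := joint st h cm pm cc pc in
  cdelta st (read_input x h) (scan c) = Some (st', d, act, o) ->
  cstep x c = Some (joint st' (minn (move d h) (size x).+1)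
    (fun t => update (cm t) (pm t) (act (Some t)).1)
    (fun t => move (act (Some t)).2 (pm t))
    (update cc pc (act None).1) (move (act None).2 pc), o).
Proof.
move=> c; rewrite /cstep /= => ->; congr (Some (_, _)).
rewrite /act_core /joint /=; congr Core; first by apply/funext => -[t|].
by apply/funext => -[t|].
Qed.

Lemma visited_None c l i : visited c l -> (c i == None) = (l <= i).
Proof.
move=> [_ /(_ i)]; case: (c i) => [u|]; case: ltnP => //= h.
Qed.

Lemma visited_flag c l i : visited c l -> cflag (c i) = (i == 0).
Proof.
move=> [l0 h]; rewrite cflagE h; case: ltnP => li; first by case: (i == 0).
by case: i li => [|i] //; lia.
Qed.

(** All heads travel at once, the input head to the left and the work heads to the right, and a head
    that has arrived waits. The induction is on a common bound [n] for the remaining distances. *)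
Lemma rewind_reach q r a k h cm pm cc pc lm L : h <= (size x).+1 ->
  (forall t, visited (cm t) (lm t)) -> (forall t, pm t <= lm t) ->
  (forall t, lm t < S) -> visited cc L -> pc <= L -> L < S ->
  reach x S (joint (PRewind, q, r, a, k) h cm pm cc pc) [::]
            (joint (PErase, q, r, a, k) 0 cm lm cc L).
Proof.
move=> hh hcm hpm hlm hcc hpc hL.
have : exists n, [/\ h <= n, forall t, lm t - pm t <= n & L - pc <= n].
  exists (h + S); split; [by lia| |by lia].
  by move=> t; have := hlm t; lia.
move=> [n]; elim: n h pm pc hh hpm hpc => [|n IH] h pm pc hh hpm hpc [hn pn cn].
  have h0 : h = 0 by lia.
  have epc : pc = L by lia.
  have epm : pm = lm by apply/funext => t; have := pn t; have := hpm t; lia.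
  rewrite h0 epc epm; apply: (keep_reach (d := Stay) (leq0n _) hlm) => //=.
  rewrite ifT; first by rewrite scanN.
  by apply/forallP => -[t|]; rewrite ffunE /= (visited_None _ (hcm _), visited_None _ hcc).
case hc : ((h == 0) && [forall j, scan (joint (PRewind, q, r, a, k) h cm pm cc pc) j == None]).
  move: hc => /andP[/eqP h0 /forallP hj].
  have epc : pc = L.
    by have := hj None; rewrite ffunE /= (visited_None _ hcc); lia.
  have epm : pm = lm.
    apply/funext => t; have := hj (Some t); have := hpm t.
    by rewrite ffunE /= (visited_None _ (hcm t)); lia.
  rewrite h0 epc epm; apply: (keep_reach (d := Stay) (leq0n _) hlm) => //=.
  rewrite ifT; first by rewrite scanN.
  by apply/forallP => -[t|]; rewrite ffunE /= (visited_None _ (hcm _), visited_None _ hcc).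
have hst : cdelta (PRewind, q, r, a, k) (read_input x h)
    (scan (joint (PRewind, q, r, a, k) h cm pm cc pc)) =
  Some ((PRewind, q, r, a, k), Lft,
    [ffun j => (scan (joint (PRewind, q, r, a, k) h cm pm cc pc) j,
       if scan (joint (PRewind, q, r, a, k) h cm pm cc pc) j is Some _ then Rgt else Stay)],
    None).
  move: hc; rewrite /=; case: h {hh hn} => [|h] /= ; last by case: onth.
  by move=> ->.
have := joint_step hst => hst'.
apply: reach_trans (reach_step _ hst') _ => [|/=].
  by apply: joint_pos; [move=> t; have := hpm t; have := hlm t|]; lia.
set pm' := fun t : tm_tape M => if pm t < lm t then (pm t).+1 else pm t.
set pc' := if pc < L then pc.+1 else pc.
rewrite [X in reach _ _ X](_ : _ = joint (PRewind, q, r, a, k) h.-1 cm pm' cc pc').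
  apply: IH; rewrite /pm' /pc'.
  - by lia.
  - by move=> t; case: ifP => // _; have := hpm t; lia.
  - by case: ifP; lia.
  - split; [by lia| |by case: ifP; lia].
    by move=> t; case: ifP => //; have := pn t; have := hpm t; lia.
have hN u : (if u is Some _ then Rgt else Stay) = if u == None :> symb then Stay else Rgt.
  by case: u.
apply: eq_joint => //.
- by apply/minn_idPl; lia.
- by apply/funext => t; rewrite !ffunE /= update_id.
- apply/funext => t; rewrite !ffunE /= hN (visited_None _ (hcm t)) /pm' ltnNge.
  by case: leqP.
- by rewrite !ffunE /= update_id.
- rewrite !ffunE /= hN (visited_None _ hcc) /pc' ltnNge.
  by case: leqP.
Qed.

Lemma all_flag st h cm pm cc pc lm L : (forall t, visited (cm t) (lm t)) -> visited cc L ->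
  [forall j, cflag (scan (joint st h cm pm cc pc) j)] =
  (pc == 0) && [forall t, pm t == 0].
Proof.
move=> hcm hcc; apply/forallP/andP => [hj|[/eqP pc0 /forallP ht] [t|]].
- split; first by have := hj None; rewrite ffunE /= (visited_flag _ hcc).
  by apply/forallP => t; have := hj (Some t); rewrite ffunE /= (visited_flag _ (hcm t)).
- by rewrite ffunE /= (visited_flag _ (hcm _)).
- by rewrite ffunE /= (visited_flag _ hcc) pc0.
Qed.

(** A head of M starts on the first unvisited cell and afterwards stands on the last visited one, so
    nothing is left to its right. The counter tape is copied instead of cleared; its invariant is
    that position and countdown agree beyond the head. *)
Lemma erase_reach q r a k cm pm pc lm P Q L :
  (forall t, visited (cm t) (lm t)) ->
  (forall t, pm t = lm t \/ pm t = (lm t).-1) ->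
  (forall t, lm t < S) -> pc <= L -> 0 < L -> L < S ->
  (forall i, pc < i -> Q i = P i) ->
  reach x S (joint (PErase, q, r, a, k) 0 cm pm (encC P Q L) pc) [::]
    (joint
        (PDec, q, tm_start M, None, k) 0 (fun _ => encM (fun _ => tm_blank M) 1)
        (fun _ => 0) (encC P P L) 0).
Proof.
move=> hcm hpm hlm hpc L0 hL hQ.
have : exists n, (forall t, pm t < n) /\ pc < n.
  exists S; split; last by lia.
  by move=> t; have := hpm t; have := hlm t; lia.
move=> [n]; elim: n cm pm lm pc Q hcm hpm hlm hpc hQ
  => [|n IH] cm pm lm pc Q hcm hpm hlm hpc hQ [pn cn] //.
have hpS t : pm t < S by have := hpm t; have := hlm t; lia.
have hcc : visited (encC P Q L) L by apply: visited_enc.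
have hst := @joint_step (PErase, q, r, a, k) 0 cm pm (encC P Q L) pc _ _ _ _ erefl.
apply: reach_trans (reach_step _ hst) _ => [|/=].
  by apply: joint_pos => //; lia.
rewrite (all_flag _ _ _ _ hcm hcc).
case: andP => [[/eqP pc0 /forallP ht]|hne].
  rewrite [X in reach _ _ X](_ : _ = joint
        (PDec, q, tm_start M, None, k) 0 (fun _ => encM (fun _ => tm_blank M) 1)
        (fun _ => 0) (encC P P L) 0); first exact: reach0.
  apply: eq_joint => //.
  - apply/funext => t; have pt := eqP (ht t); apply/funext => i.
    have [l0 hi] := hcm t; rewrite /update /encM /enc pt !ffunE /= (visited_flag _ (hcm t)) pt eqxx /=.
    case: i => [|i] //=; have := hi i.+1; have := hpm t; rewrite pt => hl.
    by rewrite ifF; [case: (cm t i.+1)|lia].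
  - by apply/funext => t; rewrite !ffunE /= (visited_flag _ (hcm t)) (ht t) (eqP (ht t)).
  - apply/funext => i; rewrite /update !ffunE /= pc0 /encC /enc.
    case: i => [|i] /=; first by rewrite L0.
    by rewrite hQ ?pc0.
  - by rewrite !ffunE /= (visited_flag _ hcc) pc0.
rewrite [X in reach _ _ X](_ : _ = joint (PErase, q, r, a, k) 0
  (fun t => update (cm t) (pm t) (if pm t == 0 then cleft M else None))
  (fun t => (pm t).-1) (encC P (update Q pc (P pc)) L) pc.-1).
  (* Clearing the cell under the head leaves as many visited cells as its position, except that the
     leftmost cell is rewritten and stays. *)
  apply: (IH _ _ (fun t => maxn 1 (pm t))).
  - move=> t; split; first by rewrite leq_max.
    have [l0 hi] := hcm t; move=> i; rewrite /update; case: eqP => [->|ne].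
      by case: eqP => [->|] //=; case: ifP => //; lia.
    by rewrite hi; have := hpm t; case: eqP => //; do 2 case: ifP => //; lia.
  - by move=> t; right; lia.
  - by move=> t; have := hlm t; have := hpS t; have [l0 _] := hcm t; have := hpm t; lia.
  - by lia.
  - by move=> i hi; rewrite /update; case: eqP => [->//|?]; apply: hQ; lia.
  - have n0 : 0 < n.
      case: (posnP n) => // n0; case: hne; split; first by lia.
      by apply/forallP => t; have := pn t; lia.
    by split=> [t|]; [have := pn t|]; lia.
apply: eq_joint => //.
- by apply/funext => t; rewrite !ffunE /= (visited_flag _ (hcm t)); case: eqP.
- by apply/funext => t; rewrite !ffunE /= (visited_flag _ (hcm t)); case: eqP => [->|].
- apply/funext => i; rewrite /update !ffunE /= /encC /enc.
  by case: eqP => [->|//]; case: ifP.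
- by rewrite !ffunE /= (visited_flag _ hcc); case: eqP => [->|].
Qed.

Definition idle (cm : tm_tape M -> nat -> symb) (pm lm : tm_tape M -> nat) :=
  forall t, [/\ visited (cm t) (lm t), pm t <= lm t & lm t <= s.+1].

(** Everything that the next rewind and erasure discard is existential: the input head, the tapes of
    M and the countdown. *)
Definition ready q (a : mark Sigma) (P : nat -> bool) (L : nat) (c : ccore) :=
  exists r h cm pm lm Q, [/\ h <= (size x).+1, idle cm pm lm &
    c = joint (PEmit, q, r, a, ord0) h cm pm (encC P Q L) 0].

Definition sim ph q a k (c : core M) lm cc : ccore :=
  joint (ph, q, co_state c, a, k) (co_head c)
     (fun t => encM (co_cell c t) (lm t)) (co_pos c) cc 0.

(** [lm] counts the visited cells. A head may stand on the first unvisited cell, which [csim] reads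
    as blank. *)
Definition tracked (c : core M) lm := forall t,
  [/\ 0 < lm t, lm t <= s.+1, co_pos c t <= lm t &
      forall i, lm t <= i -> co_cell c t i = tm_blank M].

Lemma tracked_idle c lm : tracked c lm ->
  idle (fun t => encM (co_cell c t) (lm t)) (co_pos c) lm.
Proof. by move=> h t; have [h1 h2 h3 _] := h t; split=> //; apply: visited_enc. Qed.

Lemma scan_sim ph q a k c lm cc : tracked c lm ->
  [ffun j => csim (scan (sim ph q a k c lm cc) (Some j))] = scan c.
Proof.
move=> h; apply/ffunP => t; rewrite !ffunE /= /encM /enc.
by case: leqP => //= hl; have [_ _ _ ->] := h t.
Qed.

Lemma sim_step q a k c lm cc d o : 0 < S -> (forall t, co_pos c t < s) ->
  tracked c lm -> co_head c <= (size x).+1 -> cstep x c = Some (d, o) ->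
  exists2 lm', tracked d lm' &
    cstep x (sim PSim q a k c lm cc) =
    Some (sim (if o is Some _ then PDec else PSim) q
              (if o is Some b then Some (Some b) else a) k d lm' cc, None).
Proof.
(* A step visits the cell under each head, if it was unvisited. *)
move=> S0 hp ht hh hc; exists (fun t => maxn (lm t) (co_pos c t).+1).
  move: hc; rewrite /cstep; case: tm_delta => [[[[r m] act] o']|] // [<- _] t.
  have [h1 h2 h3 h4] := ht t; have := hp t; split; rewrite /= ?leq_max ?h1 //.
  - by lia.
  - by case: (act t).2 => /=; lia.
  - by move=> i hi; rewrite ifF ?h4 //; lia.
move: hc; rewrite {1}/cstep; case E: tm_delta => [[[[r m] act] o']|] // [<- <-].
have := @joint_step (PSim, q, co_state c, a, k) (co_head c)
   (fun t => encM (co_cell c t) (lm t)) (co_pos c) cc 0.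
rewrite /cdelta -/(sim PSim q a k c lm cc) scan_sim // E => /(_ _ _ _ _ erefl) ->.
congr (Some (_, _)); apply: eq_joint => //=.
- apply/funext => t; apply/funext => i.
  have [h1 h2 h3 h4] := ht t.
  rewrite /update !ffunE /= /encM (visited_flag _ (visited_enc _ _ _ h1)) /enc.
  case: eqP => [->|ne]; first by rewrite ifT //; lia.
  by congr (if _ then _ else _); lia.
- by apply/funext => t; rewrite ffunE.
- by rewrite ffunE /=; apply/funext => i; rewrite /update; case: eqP => [->|]; rewrite ?ffunE.
- by rewrite ffunE.
Qed.

(** Induction on the run of M, with [p] symbols still to be skipped. The symbol written at countdown
    0 is the one sought; if M halts first, [onth w p] is [None], the right end marker. *)
Lemma sim_reach c w d : s.+1 < S -> reach x s c w d ->
  (forall t, co_pos d t < s) -> cstep x d = None ->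
  forall q a k P L p lm, 0 < L -> L < S -> p < 2 ^ L -> co_head c <= (size x).+1 ->
  tracked c lm ->
  exists2 c', ready q (Some (onth w p)) P L c' &
    reach x S (sim PSim q a k c lm (encC P (bit p) L)) [::] c'.
Proof.
move=> sS hr hd hn; elim: hr hd hn => {c w d} [c|c d e o w hs hc _ IH] hd hn
  q a k P L p lm L0 LS pL hh ht.
  exists (joint (PEmit, q, co_state c, Some None, ord0) (co_head c)
    (fun t => encM (co_cell c t) (lm t)) (co_pos c) (encC P (bit p) L) 0).
    do 6!eexists; split; [exact: hh|exact: tracked_idle ht|].
    by case: p {pL}.
  have hpS t : co_pos c t < S by have := hd t; lia.
  have hE : tm_delta (co_state c) (read_input x (co_head c)) (scan c) = None.
    by move: hn; rewrite /cstep; case: tm_delta => [[[[? ?] ?] ?]|].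
  have := @ctl_step (PSim, q, co_state c, a, k) _ (co_head c)
    (fun t => encM (co_cell c t) (lm t)) (co_pos c) (encC P (bit p) L) 0
    (encC P (bit p) L 0) Stay _ hh.
  rewrite /cdelta -/(sim PSim q a k c lm (encC P (bit p) L)) scan_sim // hE scanN.
  move=> /(_ _ _ erefl); rewrite update_id => hst.
  refine (reach_step (joint_pos _ _ _ _ hpS _) hst); lia.
have S0 : 0 < S by lia.
have [lm' ht' hst] := sim_step q a k (encC P (bit p) L) S0 hs ht hh hc.
have hpS t : co_pos c t < S by have := hs t; lia.
have h1 := reach_step (joint_pos _ _ _ _ hpS S0) hst.
have hh' : co_head d <= (size x).+1.
  move: hc; rewrite /cstep; case: tm_delta => [[[[r m] act] o']|] // [<- _].
  exact: geq_minr.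
have pS' t : co_pos d t < S by have [_ _] := ht' t; have [] := ht' t; lia.
case: o hc hst h1 => [b|] hc hst h1; last first.
  have [c' hr' h2] := IH hd hn q a k P L p lm' L0 LS pL hh' ht'.
  by exists c' => //; refine (reach_trans0 h2 h1).
have := @dec_reach q (co_state d) (Some (Some b)) k (co_head d)
  (fun t => encM (co_cell d t) (lm' t)) (co_pos d) L hh' pS' LS P p L0 pL.
case: p pL hst h1 => [|p] pL hst h1 /=.
  move=> [Q h2]; eexists; last by refine (reach_trans0 h2 h1).
  by do 6!eexists; split; [exact: hh'|exact: tracked_idle ht'|].
move=> h2.
have [|c' hr' h3] := IH hd hn q (Some (Some b)) k P L p lm' L0 LS _ hh' ht'.
  exact: ltnW.
by exists c' => //; refine (reach_trans0 (reach_trans0 h3 h2) h1).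
Qed.

Lemma size_out q a q' d v : tw_delta (t := T) q a = Some (q', d, v) ->
  size v <= out_bound T.
Proof.
by move=> h; have := leq_bigmax (F := fun qa : tw_state T * mark Sigma =>
  size (oapp snd [::] (tw_delta qa.1 qa.2))) (q, a); rewrite /= h.
Qed.

Lemma emit_reach q r a (k : 'I_(out_bound T).+1) h cm pm cc q' d v :
  tw_delta q a = Some (q', d, v) ->
  h <= (size x).+1 -> (forall t, pm t < S) -> 0 < S -> k <= size v ->
  exists k', reach x S (joint (PEmit, q, r, a, k) h cm pm cc 0) (drop k v)
    (joint (match d with Lft => PDecr | Stay => PRewind | Rgt => PInc end,
         q', r, a, k') h cm pm cc 0).
Proof.
move=> hT hh hp S0; have [n hn] := ubnP (size v - k).
elim: n k hn => // n IH k hn hk.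
have hst := @ctl_step (PEmit, q, r, a, k) _ h cm pm cc 0 (cc 0) Stay _ hh.
rewrite /cdelta hT scanN in hst.
move: hk; rewrite leq_eqVlt => /predU1P[hk|hk].
  rewrite hk drop_size; exists k.
  have on : onth v k = None by rewrite hk onth_default.
  rewrite on in hst; have {hst} := hst _ _ erefl => hst.
  have := reach_step (joint_pos _ _ _ _ hp S0) hst.
  by rewrite update_id.
case on : (onth v k) => [b|]; last by have := onthNE v k; rewrite on /= leqNgt hk.
rewrite on in hst; have {hst} := hst _ _ erefl; rewrite update_id => hst.
have kb : (inord k.+1 : 'I_(out_bound T).+1) = k.+1 :> nat.
  by rewrite inordK // ltnS (leq_trans hk) // (size_out hT).
have [||k' h2] := IH (inord k.+1); rewrite ?kb; first by lia.
  by [].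
exists k'; rewrite (drop_nth b) //.
rewrite (@onth_nth _ b b v k on).
rewrite kb in h2.
exact: reachS (joint_pos _ _ _ _ hp S0) hst h2.
Qed.

(** * Correctness of the composed machine *)

Section Main.
Hypothesis sS : s.+1 < S.
(** Positions are at most [(size y).+1], and a counter of more than one cell has been through
    position 2^(L-1); so the premise holds for each length [L] that occurs. *)
Hypothesis sizeS : forall L, 2 ^ L.-1 <= (size y).+1 -> L < S.
Variable d : core M.
Hypothesis M_reach : reach x s (core0 M) y d.
Hypothesis M_pos : forall t, co_pos d t < s.
Hypothesis M_halt : cstep x d = None.

Lemma fetch_reach q p r a k h cm pm lm Q L pc :
  h <= (size x).+1 -> idle cm pm lm -> p < 2 ^ L -> 0 < L ->
  2 ^ L.-1 <= (size y).+1 -> pc <= L ->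
  exists2 c', ready q (read_mark y p) (bit p) L c' &
    reach x S (joint (PRewind, q, r, a, k) h cm pm (encC (bit p) Q L) pc) [::] c'.
Proof.
move=> hh hi pL L0 /sizeS LS hpc.
have hcm t : visited (cm t) (lm t) by have [] := hi t.
have hpm t : pm t <= lm t by have [] := hi t.
have hlm t : lm t < S by have [_ _] := hi t; lia.
have h1 := rewind_reach q r a k hh hcm hpm hlm (visited_enc _ (bit p) Q L0) hpc LS.
(* [erase_reach] wants agreement beyond the head, now at [L]. The countdown bits there can be
   replaced, since [encC] does not show them. *)
have h2 := @erase_reach q r a k cm lm L lm (bit p) (fun i => if L < i then bit p i else Q i) L
  hcm (fun t => or_introl erefl) hlm (leqnn L) L0 LS.
have eQ : encC (bit p) (fun i => if L < i then bit p i else Q i) L = encC (bit p) Q L.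
  by apply/funext => i; rewrite /encC /enc; case: ltnP => // iL; rewrite ltnNge ltnW.
have hLi i : L < i -> (if L < i then bit p i else Q i) = bit p i by move=> ->.
rewrite eQ in h2; have {}h2 := h2 hLi.
have S0 : 0 < S by lia.
have := @dec_reach q (tm_start M) None k 0 (fun _ => encM (fun _ => tm_blank M) 1)
  (fun _ => 0) L (leq0n _) (fun _ => S0) LS (bit p) p L0 pL.
case: p pL h1 h2 {hLi eQ} => [|p] pL h1 h2 /=.
  (* Position 0: the countdown underflows before M has made a step, and the symbol is still [None],
     the left end marker. *)
  move=> [Q' h3]; eexists; last first.
    exact: (reach_trans0 (reach_trans0 h3 h2) (h1 _)).
  exists (tm_start M), 0, (fun _ => encM (fun _ => tm_blank M) 1), (fun _ => 0), (fun _ => 1), Q'.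
  by split=> // t; split=> //; apply: visited_enc.
move=> h3.
have [|c' hc' h4] := @sim_reach _ _ _ sS M_reach M_pos M_halt q None k (bit p.+1) L p
  (fun _ => 1) L0 LS (ltnW pL) (leq0n _); first by [].
by exists c' => //; exact: (reach_trans0 (reach_trans0 (reach_trans0 h4 h3) h2) (h1 _)).
Qed.

(** Each move of the transducer costs one fetch, one emission and one counter update; the conditions
    on [L] are the invariant. *)
Lemma trun_reach q p z : trun y q p z ->
  forall r a k h cm pm lm Q L pc,
  h <= (size x).+1 -> idle cm pm lm -> p < 2 ^ L -> 0 < L ->
  2 ^ L.-1 <= (size y).+1 -> pc <= L ->
  exists e, [/\ reach x S (joint (PRewind, q, r, a, k) h cm pm (encC (bit p) Q L) pc) z e,
    forall j, co_pos e j < S & cstep x e = None].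
Proof.
elim=> {q p z} [q p hT|q p q' m v z hT hl hsz _ IH] r a k h cm pm lm Q L pc hh hi pL L0 hL hpc.
all: have [c' [r' [h' [cm' [pm' [lm' [Q' [hh' hi' ->]]]]]]] h1] :=
  fetch_reach q r a k Q hh hi pL L0 hL hpc.
all: have hpS t : pm' t < S by have [_] := hi' t; lia.
all: have S0 : 0 < S by lia.
  eexists; split; first exact: h1.
    exact: joint_pos.
  by rewrite /cstep /= hT.
have [k' h2] := @emit_reach q r' (read_mark y p) ord0 h' cm' pm' (encC (bit p) Q' L)
  _ _ _ hT hh' hpS S0 (leq0n _).
rewrite drop0 in h2; have {}h2 := reach_trans h1 h2; rewrite /= in h2.
have LS := sizeS hL.
case: m hT hl hsz IH h2 => hT hl hsz IH h2.
- have [j' j'L h3] := @move_decr q' r' (read_mark y p) k' h' cm' pm' L hh' hpS LS Q' p 0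
    (hl erefl) pL (leq0n _) (dvd1n _).
  have [|e [h4 h5 h6]] := IH r' (read_mark y p) k' h' cm' pm' lm' Q' L j' hh' hi' _ L0 hL j'L.
    exact: leq_ltn_trans (leq_pred _) pL.
  by exists e; split=> //; exact: reach_trans h2 (reach_trans0 h4 h3).
- have [e [h4 h5 h6]] := IH r' (read_mark y p) k' h' cm' pm' lm' Q' L 0 hh' hi' pL L0 hL (leq0n _).
  by exists e; split=> //; exact: reach_trans h2 h4.
- have [Q2 [j' [L' [j'L pL' hL' h3]]]] :=
    @move_incr q' r' (read_mark y p) k' h' cm' pm' L hh' hpS LS Q' p 0
    L0 pL (leq0n _) (dvd1n _).
  have [||e [h4 h5 h6]] := IH r' (read_mark y p) k' h' cm' pm' lm' Q2 L' j' hh' hi' pL' _ _ j'L.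
  + by case: hL' => [->|[->]].
  (* If the counter has grown, 2^L is the new position, bounded by the side condition of
     [trun_move]. *)
  + by case: hL' => [->|[-> <-]].
  by exists e; split=> //; exact: reach_trans h2 (reach_trans0 h4 h3).
Qed.

Lemma compose_reach z : trun y (tw_start T (nilp x)) 0 z ->
  outputs C x z /\ in_space C x S.
Proof.
move=> hT; have S0 : 0 < S by lia.
pose P0 := (PStart, tw_start T true, tm_start M, @None (option Sigma), @ord0 (out_bound T)).
pose P1 := (PProbe, tw_start T true, tm_start M, @None (option Sigma), @ord0 (out_bound T)).
pose P2 := (PRewind, tw_start T (nilp x), tm_start M, @None (option Sigma), @ord0 (out_bound T)).
(* The boolean [b] also serves as the position of the input head: cell 1 while probing for an empty
   input, then cell 0. *)
pose init b := joint (if b then P1 else P2) b (fun _ => encM (fun _ => tm_blank M) 1)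
  (fun _ => 0) (encC (bit 0) (bit 0) 1) 0.
have e0 : core0 C = joint P0 0 (fun _ _ => None) (fun _ => 0) (fun _ => None) 0.
  by congr Core; apply/funext => -[].
have bit0 i : bit 0 i = false by rewrite /bit div0n.
have h1 : reach x S (core0 C) [::] (init true).
  rewrite e0; have := joint_step (h := 0) (cm := fun _ _ => None) (pm := fun _ => 0)
    (cc := fun _ => None) (pc := 0) (erefl (cdelta P0 _ _)) => hst.
  have := reach_step (joint_pos _ _ _ _ (fun _ => S0) S0) hst.
  rewrite [X in reach _ _ _ _ X](_ : _ = init true) //.
  apply: eq_joint => //.
  - by rewrite /= minnSS min0n.
  - by apply/funext => t; apply/funext => -[|i]; rewrite /update ffunE.
  - by apply/funext => t; rewrite ffunE.
  - by apply/funext => -[|i]; rewrite /update ffunE //= /encC /enc !bit0.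
  - by rewrite ffunE.
have h2 : reach x S (init true) [::] (init false).
  have := joint_step (st := P1) (h := 1) (cm := fun _ => encM (fun _ => tm_blank M) 1)
    (pm := fun _ => 0) (cc := encC (bit 0) (bit 0) 1) (pc := 0) erefl => hst.
  have := reach_step (joint_pos _ _ _ _ (fun _ => S0) S0) hst.
  rewrite [X in reach _ _ _ _ X](_ : _ = init false) //.
  apply: eq_joint => //.
  - by rewrite /P2 /=; case: x => [|b x'].
  - by apply/funext => t; rewrite !ffunE /= update_id.
  - by apply/funext => t; rewrite ffunE.
  - by rewrite !ffunE /= update_id.
  - by rewrite ffunE.
have [|||||e [h3 h4 h5]] := @trun_reach _ _ _ hT (tm_start M) None ord0 0
  (fun _ => encM (fun _ => tm_blank M) 1)
  (fun _ => 0) (fun _ => 1) (bit 0) 1 0 (leq0n _) => //.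
  by move=> t; split=> //; apply: visited_enc.
apply: reach_outputs h4 h5.
exact: reach_trans0 (reach_trans0 h3 h2) h1.
Qed.
End Main.

End ComposeRun.

(** * Logarithmic space for the composition *)

Lemma leq_expr m n e : m <= n -> m ^ e <= n ^ e.
Proof. by case: e => // e; rewrite leq_exp2r. Qed.

Lemma leq_exp2_mul a n : a ^ n <= 2 ^ (a * n).
Proof. by rewrite expnM; apply: leq_expr; apply: ltnW; apply: ltn_expl. Qed.

(** With n < 2^l, each factor of [config_bound] is bounded by a power of 2 whose exponent is a
    constant times [l]; the crude a^n <= 2^(an) takes care of the alphabet. *)
Lemma config_bound_leq (Sigma : finType) (M : transducer Sigma) c n l :
  l = (trunc_log 2 n).+1 ->
  config_bound M (nseq n true) (c * l) <=
  2 ^ ((#|tm_state M| + 2 + (#|tm_symb M| + 1) * c.+1 * #|tm_tape M|) * l).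
Proof.
move=> hl; have l0 : 0 < l by rewrite hl.
have sl : (c * l).+1 <= c.+1 * l by rewrite mulSn; lia.
rewrite /config_bound size_nseq.
rewrite [X in 2 ^ X](_ : _ = #|tm_state M| * l + (l + l) +
  (#|tm_symb M| + 1) * (c.+1 * l) * #|tm_tape M|); last by nia.
rewrite 2![2 ^ (_ + _ : nat)]expnD; apply: leq_mul; first apply: leq_mul.
- apply: leq_trans (ltnW (ltn_expl _ (isT : 1 < 2))) _.
  by rewrite leq_exp2l // leq_pmulr.
- have := trunc_log_ltn n (isT : 1 < 2); rewrite -hl => h.
  have := ltn_expl l (isT : 1 < 2); rewrite expnD; move: (2 ^ l) h => u; nia.
- rewrite expnM; apply: leq_expr.
  rewrite mulnDl mul1n expnD; apply: leq_mul.
    by apply: leq_trans (leq_exp2_mul _ _) _; rewrite leq_exp2l // leq_mul2l sl orbT.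
  by apply: leq_trans sl _; apply: ltnW; apply: ltn_expl.
Qed.

(** In the constant, [b] pays for the counter and [c] for the tapes of M; the 3 leaves room for the
    off-by-ones. *)
Lemma compose_logspace (Sigma Delta : finType) (M : transducer Sigma)
    (T : twoway Sigma Delta) (y : nat -> seq Sigma) (z : nat -> seq Delta) :
  logspace M -> (forall n, outputs M (nseq n true) (y n)) ->
  (forall n, trun (y n) (tw_start T (n == 0)) 0 (z n)) ->
  logspace (compose M T) /\ forall n, outputs (compose M T) (nseq n true) (z n).
Proof.
move=> [c hc] hy hz.
pose b := #|tm_state M| + 2 + (#|tm_symb M| + 1) * c.+1 * #|tm_tape M|.
suff h n : outputs (compose M T) (nseq n true) (z n) /\
    in_space (compose M T) (nseq n true) ((b + c + 3) * (trunc_log 2 n).+1).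
  by split=> [|n]; [exists (b + c + 3) => n|]; have [] := h n.
have [d [h1 h2 h3 h4]] := outputs_reach (hc n) (hy n).
have hb := leq_trans h4 (config_bound_leq M c (erefl (trunc_log 2 n).+1)); rewrite -/b in hb.
apply: (compose_reach _ _ h1 h2 h3); last by have := hz n; case: n {h1 h2 h3 h4 hb}.
- by rewrite !mulnDl; lia.
- move=> L /leq_trans /(_ hb); rewrite leq_exp2l // !mulnDl; lia.
Qed.

(** * The transducer rewriting circuit descriptions *)

(** [MSkip] runs to the right end. [MBack] walks left, translating each gate from its opening token,
    and [MRewind] returns to that token. At the left end the middle gates are written; [MHome]
    passes over the width, and [MNext] translates rightwards. *)
Inductive mode :=
  MWidth | MSkip | MBack | MIndex | MFst | MSnd | MRewind | MHome | MNext | MEnd.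

Definition nat_of_mode (a : mode) : 'I_10 :=
  inord match a with
  | MWidth => 0 | MSkip => 1 | MBack => 2 | MIndex => 3 | MFst => 4
  | MSnd => 5 | MRewind => 6 | MHome => 7 | MNext => 8 | MEnd => 9 end.

Definition mode_of_nat (m : 'I_10) : mode :=
  nth MWidth [:: MWidth; MSkip; MBack; MIndex; MFst; MSnd; MRewind; MHome;
                 MNext; MEnd] m.

Lemma nat_of_modeK : cancel nat_of_mode mode_of_nat.
Proof. by case; rewrite /mode_of_nat inordK. Qed.

HB.instance Definition _ := Finite.copy mode (can_type nat_of_modeK).

(* How the CNot being translated is controlled; an uncontrolled one is copied
   in two passes, KTwice and then KAgain. *)
Inductive kind := KPos | KNeg | KTwice | KAgain.

Definition nat_of_kind (a : kind) : 'I_4 :=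
  inord match a with KPos => 0 | KNeg => 1 | KTwice => 2 | KAgain => 3 end.

Definition kind_of_nat (m : 'I_4) : kind :=
  nth KPos [:: KPos; KNeg; KTwice; KAgain] m.

Lemma nat_of_kindK : cancel nat_of_kind kind_of_nat.
Proof. by case; rewrite /kind_of_nat inordK. Qed.

HB.instance Definition _ := Finite.copy kind (can_type nat_of_kindK).

Definition is_digit (a : token) : bool :=
  match a with TMark | TStop => true | _ => false end.

(** A lone [TStop] is the number 0: the first input bit at the front of each triple, the first qubit
    after each letter. *)
Definition middle : seq token :=
  flatten [seq [:: TStop; a; TStop; a; TStop] |
           a <- [:: THad; TPhase; TPhase; TPhase; TPhase; THad]].

(* The boolean tells, for MWidth, whether to stop after the width, and for the
   modes that translate a gate, whether the reversed list is being written. *)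
Definition rstate : Type := (mode * bool * kind)%type.

Definition enter (r : bool) (a : token) : option (rstate * dir * seq token) :=
  match a with
  | TPos => Some (MIndex, r, KPos, Rgt, [::])
  | TNeg => Some (MIndex, r, KNeg, Rgt, [::])
  | TFree => Some (MFst, r, KTwice, Rgt, [:: TStop; TCNot])
  | _ => None
  end.

(** The first gate of a triple is for bit value 0, so the identity goes before the CNot for [KPos]
    and after it for [KNeg]. *)
Definition rdelta (q : rstate) (c : mark token) :
    option (rstate * dir * seq token) :=
  let: (m, r, k) := q in
  match m, c with
  | MWidth, None => Some (q, Rgt, [::])
  | MWidth, Some (Some TMark) => Some (q, Rgt, [:: TMark])
  | MWidth, Some (Some TStop) =>
      Some ((if r then MEnd else MSkip), r, k, Rgt, [:: TStop])
  | MSkip, Some (Some _) => Some (q, Rgt, [::])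
  | MSkip, Some None => Some (MBack, true, k, Lft, [::])
  | MBack, None => Some (MHome, false, k, Rgt, middle)
  | MBack, Some (Some a) => if is_digit a then Some (q, Lft, [::]) else enter true a
  | MIndex, Some (Some TMark) => Some (q, Rgt, [:: TMark])
  | MIndex, Some (Some TStop) =>
      Some (MFst, r, k, Rgt,
            if k is KPos then [:: TStop; TId; TCNot] else [:: TStop; TCNot])
  | MFst, Some (Some TMark) => Some (q, Rgt, [:: TMark])
  | MFst, Some (Some TStop) => Some (MSnd, r, k, Rgt, [:: TStop])
  | MSnd, Some (Some TMark) => Some (q, Rgt, [:: TMark])
  | MSnd, Some (Some TStop) =>
      let out := if k is KNeg then [:: TStop; TId] else [:: TStop] in
      if r || (if k is KTwice then true else false)
      then Some (MRewind, r, k, Lft, out) else Some (MNext, r, k, Rgt, out)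
  | MRewind, Some (Some a) =>
      if is_digit a then Some (q, Lft, [::])
      else if k is KTwice then Some (MFst, r, KAgain, Rgt, [:: TCNot])
      else Some (MBack, r, k, Lft, [::])
  | MHome, Some (Some TMark) => Some (q, Rgt, [::])
  | MHome, Some (Some TStop) => Some (MNext, false, k, Rgt, [::])
  | MNext, Some (Some a) => enter false a
  | _, _ => None
  end.

Definition rewriter : twoway token token :=
  @TwoWay token token rstate (fun e => (MWidth, e, KPos)) rdelta.

Section Rewriter.
Variable y : seq token.
Notation run := (@trun token token rewriter y).

Lemma read_cat u a v : y = u ++ a :: v -> read_mark y (size u).+1 = Some (Some a).
Proof. by move=> ->; rewrite /= onth_cat ltnn subnn. Qed.

Lemma run_right q u a v q' o z : y = u ++ a :: v ->
  rdelta q (Some (Some a)) = Some (q', Rgt, o) ->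
  run q' (size (rcons u a)).+1 z -> run q (size u).+1 (o ++ z).
Proof.
move=> e hq; rewrite size_rcons => h.
apply: (@trun_move _ _ rewriter y q _ q' Rgt) => //; first by rewrite (read_cat e).
by rewrite /= e size_cat /=; lia.
Qed.

Lemma run_left q u a v q' o z : y = u ++ a :: v ->
  rdelta q (Some (Some a)) = Some (q', Lft, o) ->
  run q' (size u) z -> run q (size u).+1 (o ++ z).
Proof.
move=> e hq h.
apply: (@trun_move _ _ rewriter y q _ q' Lft) => //; first by rewrite (read_cat e).
by rewrite /= e size_cat /=; lia.
Qed.

Lemma run_marks q o u i v z : y = u ++ nseq i TMark ++ v ->
  rdelta q (Some (Some TMark)) = Some (q, Rgt, o) ->
  run q (size (u ++ nseq i TMark)).+1 z ->
  run q (size u).+1 (flatten (nseq i o) ++ z).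
Proof.
move=> + hq; elim: i u z => [|i IH] u z e h; first by rewrite cats0 in h.
rewrite /= -catA; apply: (run_right e hq).
by apply: IH; rewrite ?cat_rcons // e.
Qed.

Lemma run_digits_back q u w v z : y = u ++ w ++ v -> all is_digit w ->
  (forall a, is_digit a -> rdelta q (Some (Some a)) = Some (q, Lft, [::])) ->
  run q (size u) z -> run q (size (u ++ w)) z.
Proof.
move=> + + hq; elim/last_ind: w v => [|w a IH] v e; first by rewrite cats0.
rewrite all_rcons => /andP[ha hw] h; rewrite -rcons_cat size_rcons -[z]cat0s.
apply: (@run_left q (u ++ w) a v); [|exact: hq|].
  by rewrite e cat_rcons catA.
by apply: (IH (a :: v)); rewrite // e cat_rcons.
Qed.

Lemma flatten_nseq1 i : flatten (nseq i [:: TMark]) = nseq i TMark.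
Proof. by elim: i => //= i ->. Qed.

Lemma flatten_nseq0 i : flatten (nseq i [::]) = [::] :> seq token.
Proof. by elim: i. Qed.

Lemma run_copy q u i v q' o z : y = u ++ describe_nat i ++ v ->
  rdelta q (Some (Some TMark)) = Some (q, Rgt, [:: TMark]) ->
  rdelta q (Some (Some TStop)) = Some (q', Rgt, TStop :: o) ->
  run q' (size (u ++ describe_nat i)).+1 z ->
  run q (size u).+1 (describe_nat i ++ o ++ z).
Proof.
rewrite /describe_nat cat_rcons => e h1 h2 h3; rewrite cat_rcons -flatten_nseq1.
apply: (run_marks e h1).
apply: (run_right _ h2); first by rewrite e catA.
by rewrite rcons_cat.
Qed.

Lemma digits_nat i : all is_digit (describe_nat i).
Proof. by rewrite all_rcons all_nseq orbT. Qed.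

Lemma run_pair r k pre a d j l post z :
  y = pre ++ a :: d ++ describe_nat j ++ describe_nat l ++ post ->
  is_digit a = false -> all is_digit d -> k <> KTwice ->
  (forall k', if r then run (MBack, true, k') (size pre) z
    else run (MNext, false, k')
      (size (pre ++ a :: d ++ describe_nat j ++ describe_nat l)).+1 z) ->
  run (MFst, r, k) (size (rcons pre a ++ d)).+1
    (describe_nat j ++ describe_nat l ++ (if k is KNeg then [:: TId] else [::]) ++ z).
Proof.
move=> e ha hd hk hz.
have e1 : y = (rcons pre a ++ d) ++ describe_nat j ++ describe_nat l ++ post.
  by rewrite e cat_rcons -catA.
rewrite -[describe_nat l ++ _ ++ z]cat0s; apply: (run_copy e1) => //.
have e2 : y = ((rcons pre a ++ d) ++ describe_nat j) ++ describe_nat l ++ post.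
  by rewrite e1 -!catA.
case: r hz => hz; last first.
  apply: (run_copy e2) => //; first by case: k hk {hz}.
  by rewrite -!catA cat_rcons; apply: hz.
rewrite [X in run _ _ X](_ : _ = flatten (nseq l [:: TMark]) ++
  (TStop :: (if k is KNeg then [:: TId] else [::])) ++ z); last first.
  by rewrite flatten_nseq1 /describe_nat cat_rcons.
have e3 : y = ((rcons pre a ++ d) ++ describe_nat j) ++ nseq l TMark ++ TStop :: post.
  by rewrite e2 [describe_nat l]/describe_nat -[in RHS]cat_rcons.
apply: (run_marks e3) => //.
have e4 : y = (((rcons pre a ++ d) ++ describe_nat j) ++ nseq l TMark) ++ TStop :: post.
  by rewrite e3 -!catA.
apply: (@run_left _ _ _ _ (MRewind, true, k) _ _ e4); first by case: k hk {hz}.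
rewrite -!catA; apply: (@run_digits_back _ (rcons pre a) _ (TStop :: post)).
- by rewrite e4 -!catA.
- by rewrite !all_cat hd digits_nat all_nseq orbT.
- by case.
rewrite size_rcons -[z]cat0s.
apply: (@run_left _ _ _ _ (MBack, true, k) _ _ e) => //.
by rewrite /= ha; case: k hk {hz}.
Qed.

Lemma run_twice r pre a j l post z :
  y = pre ++ a :: describe_nat j ++ describe_nat l ++ post ->
  is_digit a = false ->
  (forall k', if r then run (MBack, true, k') (size pre) z
    else run (MNext, false, k')
      (size (pre ++ a :: describe_nat j ++ describe_nat l)).+1 z) ->
  run (MFst, r, KTwice) (size (rcons pre a)).+1
    (describe_nat j ++ describe_nat l ++
       TCNot :: describe_nat j ++ describe_nat l ++ z).
Proof.
move=> e ha hz.
have e1 : y = rcons pre a ++ describe_nat j ++ describe_nat l ++ post.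
  by rewrite e cat_rcons.
rewrite -[describe_nat l ++ TCNot :: _]cat0s; apply: (run_copy e1) => //.
rewrite [X in run _ _ X](_ : _ = flatten (nseq l [:: TMark]) ++
  [:: TStop] ++ TCNot :: describe_nat j ++ describe_nat l ++ z); last first.
  by rewrite flatten_nseq1 {1}/describe_nat cat_rcons.
have e3 : y = (rcons pre a ++ describe_nat j) ++ nseq l TMark ++ TStop :: post.
  by rewrite e1 [describe_nat l]/describe_nat -[in RHS]cat_rcons -!catA.
apply: (run_marks e3) => //.
have e4 : y = ((rcons pre a ++ describe_nat j) ++ nseq l TMark) ++ TStop :: post.
  by rewrite e3 -!catA.
apply: (@run_left _ _ _ _ (MRewind, r, KTwice) _ _ e4); first by case: (r).
rewrite -!catA; apply: (@run_digits_back _ (rcons pre a) _ (TStop :: post)).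
- by rewrite e4 -!catA.
- by rewrite !all_cat digits_nat all_nseq orbT.
- by case.
rewrite size_rcons -cat1s.
apply: (@run_right _ _ _ _ (MFst, r, KAgain) _ _ e); first by rewrite /= ha.
rewrite -[rcons pre a]cats0.
by apply: (@run_pair r KAgain pre a [::] j l post).
Qed.

(** Gates stripped of the dependence on width and input length, which the token machine does not
    see. *)
Definition rawgate : Type := (option (nat * bool) * (nat * nat))%type.

Definition gate_in (g : rawgate) : seq token :=
  (if g.1 is Some (i, b) then (if b then TPos else TNeg) :: describe_nat i
   else [:: TFree]) ++ describe_nat g.2.1 ++ describe_nat g.2.2.

Definition gate_out (g : rawgate) : seq token :=
  let c := TCNot :: describe_nat g.2.1 ++ describe_nat g.2.2 in
  if g.1 is Some (i, b) then
    describe_nat i ++ (if b then TId :: c else c ++ [:: TId])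
  else TStop :: c ++ c.

Lemma run_gate r q pre g post z : y = pre ++ gate_in g ++ post ->
  (forall a, is_digit a = false -> rdelta q (Some (Some a)) = enter r a) ->
  (forall k', if r then run (MBack, true, k') (size pre) z
    else run (MNext, false, k') (size (pre ++ gate_in g)).+1 z) ->
  run q (size pre).+1 (gate_out g ++ z).
Proof.
case: g => [[[i b]|] [j l]]; rewrite /gate_in /gate_out /= => e hq hz; last first.
  rewrite [X in run _ _ X](_ : _ = [:: TStop; TCNot] ++ describe_nat j ++
    describe_nat l ++ TCNot :: describe_nat j ++ describe_nat l ++ z); last first.
    by rewrite /= -!catA /= -!catA.
  rewrite /= -catA in e.
  apply: (@run_right _ _ _ _ (MFst, r, KTwice) _ _ e); first by rewrite hq.
  exact: (run_twice e).
rewrite -catA -[X in run _ _ X]cat0s.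
set a := if b then TPos else TNeg.
apply: (@run_right _ _ _ _ (MIndex, r, if b then KPos else KNeg) _ _ _).
- by rewrite e -catA.
- by rewrite hq /a; case: (b).
have e1 : y = rcons pre a ++ describe_nat i ++ describe_nat j ++ describe_nat l ++ post.
  by rewrite e cat_rcons -!catA.
rewrite (_ : _ ++ z = (if b then [:: TId; TCNot] else [:: TCNot]) ++
   describe_nat j ++ describe_nat l ++ (if b then [::] else [:: TId]) ++ z); last first.
  by case: (b); rewrite /= -?catA.
apply: (@run_copy _ _ _ _ (MFst, r, if b then KPos else KNeg) _ _ e1) => //.
  by case: (b).
have -> : (if b then [::] else [:: TId]) =
    (if (if b then KPos else KNeg) is KNeg then [:: TId] else [::]).
  by case: (b).
apply: (run_pair (post := post)); rewrite ?digits_nat //.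
- by rewrite e -!catA.
- by rewrite /a; case: (b).
- by case: (b).
Qed.

(** Only the opening token of a gate is not a digit. This is how gate boundaries are found when
    walking left. *)
Lemma gate_in_digits g : exists a d,
  [/\ gate_in g = a :: d, is_digit a = false & all is_digit d].
Proof.
case: g => [[[i b]|] [j l]]; rewrite /gate_in /=; do 2!eexists; split=> //.
- by case: (b).
- by rewrite !all_cat !digits_nat.
- by rewrite all_cat !digits_nat.
Qed.

Lemma run_next gs k pre : y = pre ++ flatten (map gate_in gs) ->
  run (MNext, false, k) (size pre).+1 (flatten (map gate_out gs)).
Proof.
elim: gs k pre => [|g gs IH] k pre /= e.
  by rewrite cats0 in e; apply: trun_halt; rewrite /= -e onth_default.
apply: (run_gate e); first by [].
by move=> k'; apply: IH; rewrite -catA.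
Qed.

Lemma run_back gs pre post z : y = pre ++ flatten (map gate_in gs) ++ post ->
  (forall k, run (MBack, true, k) (size pre) z) ->
  forall k, run (MBack, true, k) (size (pre ++ flatten (map gate_in gs)))
    (flatten (map gate_out (rev gs)) ++ z).
Proof.
move=> + hz; elim/last_ind: gs post => [|gs g IH] post e k; first by rewrite cats0.
rewrite rev_rcons /=.
move: e; rewrite map_rcons flatten_rcons => e.
have [a [d [eg ha hd]]] := gate_in_digits g.
rewrite eg -cat_rcons !catA -rcons_cat.
apply: (@run_digits_back _ _ d post) => //.
- by rewrite e eg rcons_cat -!catA cat_rcons.
- by case.
rewrite size_rcons -catA; apply: (@run_gate true _ _ _ post).
- by rewrite e -!catA.
- by case.
by move=> k'; apply: IH; rewrite e -!catA.
Qed.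

Lemma run_skip u v k z : y = u ++ v -> run (MSkip, false, k) (size y).+1 z ->
  run (MSkip, false, k) (size u).+1 z.
Proof.
elim: v u => [|a v IH] u e h; first by rewrite cats0 in e; rewrite -e.
rewrite -[z]cat0s; apply: (@run_right _ _ _ _ (MSkip, false, k) _ _ e) => //.
by apply: IH; rewrite // cat_rcons.
Qed.

Lemma rewriter_run w gs : y = describe_nat w ++ flatten (map gate_in gs) ->
  run (MWidth, false, KPos) 0
    (describe_nat w ++ flatten (map gate_out (rev gs)) ++ middle ++
     flatten (map gate_out gs)).
Proof.
move=> e; rewrite -[describe_nat w ++ _]cat0s.
apply: (@trun_move _ _ rewriter y _ _ _ Rgt) => //.
apply: (@run_copy _ [::] _ _ (MSkip, false, KPos) [::] _ e) => //.
apply: (run_skip e); rewrite -[flatten _ ++ _]cat0s.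
apply: (@trun_move _ _ rewriter y _ _ (MBack, true, KPos) Lft) => //.
  by rewrite /= onth_default.
rewrite [move _ _]/= [size y](congr1 size e); apply: (@run_back _ _ [::]); rewrite ?cats0 //.
move=> k; rewrite -[describe_nat w]cat0s.
apply: (@run_digits_back _ [::] _ (flatten (map gate_in gs))) => //.
- exact: digits_nat.
- by case.
apply: (@trun_move _ _ rewriter y _ _ (MHome, false, k) Rgt) => //.
rewrite [X in run _ _ X](_ : _ = flatten (nseq w [::]) ++ [::] ++
  flatten (map gate_out gs)); last by rewrite flatten_nseq0.
have e1 : y = [::] ++ nseq w TMark ++ TStop :: flatten (map gate_in gs).
  by rewrite e /describe_nat cat_rcons.
apply: (run_marks e1) => //.
apply: (@run_right _ _ _ _ (MNext, false, k) _ _ e1) => //.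
by apply: run_next; rewrite e.
Qed.

Lemma rewriter_run_empty w v : y = describe_nat w ++ v ->
  run (MWidth, true, KPos) 0 (describe_nat w).
Proof.
move=> e; rewrite -[describe_nat w]cat0s.
apply: (@trun_move _ _ rewriter y _ _ _ Rgt) => //.
rewrite -[describe_nat w]cats0 -[[::]]cat0s.
apply: (@run_copy _ [::] _ _ (MEnd, true, KPos) [::] _ e) => //.
by apply: trun_halt; case: read_mark => [[a|]|].
Qed.

End Rewriter.

(** * Operators on qubits *)

Section Quantum.
Local Open Scope ring_scope.
Local Open Scope complex_scope.
Variables (R : realType) (w : nat).
Notation op := (op R w).
Notation ket := (@ket R w).
Implicit Types (A B : op) (b c : bits w) (j k : 'I_w).

Lemma index_ofK : cancel (@index_of w) (@bits_of w).
Proof. by move=> b; rewrite /bits_of /index_of cast_ordK enum_rankK. Qed.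

Lemma bits_ofK : cancel (@bits_of w) (@index_of w).
Proof. by move=> s; rewrite /bits_of /index_of enum_valK cast_ordKV. Qed.

Lemma mul_ket A b s z : (A *m ket b) s z = A s (index_of b).
Proof. by rewrite ord1 /ket -colE mxE. Qed.

Lemma op_ext A B : (forall b, A *m ket b = B *m ket b) -> A = B.
Proof.
move=> h; apply/matrixP => s t.
by have /matrixP/(_ s 0) := h (bits_of t); rewrite !mul_ket bits_ofK.
Qed.

Lemma ketE b s z : ket b s z = (s == index_of b)%:R.
Proof. by rewrite mxE ord1 eqxx andbT. Qed.

Lemma ket_inj : injective ket.
Proof.
move=> b c /matrixP/(_ (index_of b) 0); rewrite !ketE eqxx.
case: eqP => [/(can_inj index_ofK)//|_] /eqP.
by rewrite oner_eq0.
Qed.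

Lemma index_eq (s : 'I_(2 ^ w)) b : (s == index_of b) = (bits_of s == b).
Proof. by rewrite -(can_eq bits_ofK s) index_ofK. Qed.

Lemma pauliX_ket j b : pauliX R j *m ket b = ket (flip j b).
Proof.
by apply/matrixP => s z; rewrite mul_ket ketE mxE index_ofK index_eq.
Qed.

Lemma pauliZ_ket j b : pauliZ R j *m ket b = (-1) ^+ b j *: ket b.
Proof.
apply/matrixP => s z; rewrite mul_ket !mxE !ord1 eqxx andbT index_eq.
by case: eqP => [->|]; rewrite ?mulr1 // mulr0.
Qed.

Definition xorb2 b c : bits w := [ffun i => b i (+) c i].

Definition cnot_act (g : cnot w) b : bits w :=
  if b (val g).1 then flip (val g).2 b else b.

Lemma flipE j b k : flip j b k = b k (+) (k == j).
Proof. by rewrite ffunE. Qed.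

Lemma cnot_ket (g : cnot w) b : cnot_mx R g *m ket b = ket (cnot_act g b).
Proof.
case: g => [[j k] /= jk]; rewrite /cnot_mx /cnot_act /=.
rewrite -scalemxAl !mulmxBl !mulmxDl mul1mx -mulmxA pauliX_ket !pauliZ_ket flipE.
rewrite (negbTE jk) addbF; case: (b j); rewrite /= ?expr1 ?expr0 ?scaleN1r ?scale1r.
  by rewrite subrr add0r opprK -mulr2n -[ket _ *+ 2]scaler_nat scalerA mulVf ?scale1r ?pnatr_eq0.
by rewrite addrK -mulr2n -[ket _ *+ 2]scaler_nat scalerA mulVf ?scale1r ?pnatr_eq0.
Qed.

Lemma flipK j : involutive (flip (w := w) j).
Proof. by move=> b; apply/ffunP => i; rewrite !flipE addbK. Qed.

Lemma cnot_actK g : involutive (cnot_act g).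
Proof.
move=> b; rewrite /cnot_act; case bj: (b (val g).1); last by rewrite bj.
by rewrite flipE bj (negbTE (valP g)) /= flipK.
Qed.

Lemma cnot_actD g b c : cnot_act g (xorb2 b c) = xorb2 (cnot_act g b) (cnot_act g c).
Proof.
rewrite /cnot_act ffunE; apply/ffunP => i.
by do 2!case: (_ (val g).1); rewrite /= ?ffunE ?flipE ?ffunE //;
  case: (b i); case: (c i); case: (i == _).
Qed.

Lemma adjointM A B : adjoint (A * B) = adjoint B * adjoint A.
Proof. by rewrite /adjoint trmx_mul map_mxM. Qed.

Lemma adjointZ a A : adjoint (a *: A) = a^* *: adjoint A.
Proof. by apply/matrixP => s t; rewrite !mxE rmorphM. Qed.

Lemma adjointE A s t : adjoint A s t = (A t s)^*.
Proof. by rewrite !mxE. Qed.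

Lemma adjoint1 : adjoint (1 : op) = 1.
Proof. by rewrite /adjoint trmx1 map_mx1. Qed.

Lemma adjoint_pauliX j : adjoint (pauliX R j) = pauliX R j.
Proof.
apply/matrixP => s t; rewrite adjointE !mxE conjc_nat.
by rewrite eq_sym (canF_eq (flipK j)) .
Qed.

Lemma adjoint_cnot (g : cnot w) : adjoint (cnot_mx R g) = cnot_mx R g.
Proof.
apply/matrixP => s t; rewrite adjointE.
have e (u v : 'I_(2 ^ w)) : cnot_mx R g u v = (bits_of u == cnot_act g (bits_of v))%:R.
  by rewrite -{1}(bits_ofK v) -(mul_ket _ _ _ 0) cnot_ket ketE index_eq.
by rewrite !e conjc_nat eq_sym (canF_eq (cnot_actK g)).
Qed.

Lemma cnot_mxK (g : cnot w) : cnot_mx R g * cnot_mx R g = 1.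
Proof. by apply: op_ext => b; rewrite -mulmxA !cnot_ket cnot_actK mul1mx. Qed.

Lemma pauliX2 j : pauliX R j * pauliX R j = 1.
Proof. by apply: op_ext => b; rewrite -mulmxA !pauliX_ket flipK mul1mx. Qed.

Lemma pauliZ2 j : pauliZ R j * pauliZ R j = 1.
Proof.
apply: op_ext => b; rewrite -mulmxA pauliZ_ket -scalemxAr pauliZ_ket mul1mx.
by rewrite scalerA -expr2 sqrr_sign scale1r.
Qed.

Lemma pauliZX j : pauliZ R j * pauliX R j = - (pauliX R j * pauliZ R j).
Proof.
apply: op_ext => b; rewrite mulNmx -!mulmxA pauliX_ket !pauliZ_ket -scalemxAr.
by rewrite pauliX_ket flipE eqxx addbT -scaleNr; case: (b j); rewrite /= ?opprK.
Qed.

(* exp (i y Z_j). *)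
Definition rotZ j (y : R) : op :=
  (cos y)%:C *: (1 : op) + ('i%C * (sin y)%:C) *: pauliZ R j.

Lemma rotZ_ket j y b :
  rotZ j y *m ket b = ((cos y)%:C + 'i%C * (sin y)%:C * (-1) ^+ b j) *: ket b.
Proof. by rewrite mulmxDl -!scalemxAl pauliZ_ket mul1mx scalerA scalerDl. Qed.

Lemma rotZM j x y : rotZ j x * rotZ j y = rotZ j (x + y).
Proof.
apply: op_ext => b; rewrite -mulmxA rotZ_ket -scalemxAr !rotZ_ket scalerA.
congr (_ *: _); rewrite cosD sinD rmorphB rmorphD !rmorphM /=.
have i2 := @sqr_i R; have s2 : ((-1 : R[i]) ^+ b j) ^+ 2 = 1 by rewrite sqrr_sign.
ring : i2 s2.
Qed.

Lemma expZ j z n :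
  (z *: pauliZ R j) ^+ n = z ^+ n *: (if odd n then pauliZ R j else 1).
Proof.
elim: n => [|n IH]; first by rewrite !expr0 scale1r.
rewrite exprS IH; apply: etrans (esym (scalemxAl _ _ _)) _.
rewrite -scalemxAr scalerA exprS /=; congr (_ *: _).
by case: (odd n); [exact: pauliZ2|exact: mulmx1].
Qed.

Lemma expi n : 'i%C ^+ n = (if odd n then 'i%C else 1) * (-1) ^+ n./2 :> R[i].
Proof.
rewrite -{1}(odd_double_half n) exprD -mul2n exprM sqr_i.
by case: (odd n).
Qed.

(** Since Z^2 = 1, even powers give the cosine series times 1 and odd powers i times the sine series
    times Z. As [y] is real, these are exactly the real and imaginary parts of each entry. *)
Lemma exp_pauliZ j (y : R) : exp_mx (('i%C * y%:C) *: pauliZ R j) = rotZ j y.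
Proof.
apply/matrixP => s t; rewrite mxE.
have hterm n : (n`!%:R^-1 *: (('i%C * y%:C) *: pauliZ R j) ^+ n) s t =
   ((s == t)%:R * cos_coeff y n) +i* ((-1) ^+ bits_of s j *+ (s == t) * sin_coeff y n).
  have -> : cos_coeff y n = (~~ odd n)%:R * (-1) ^+ n./2 * y ^+ n * n`!%:R^-1.
    by rewrite exprnP.
  have -> : sin_coeff y n = (odd n)%:R * (-1) ^+ n./2 * y ^+ n * n`!%:R^-1.
    by rewrite /sin_coeff /=; case: n => //= n; rewrite uphalf_half; case: (odd n); rewrite ?mul0r.
  rewrite expZ exprMn expi !mxE.
  have -> : (if odd n then pauliZ R j else 1) s t =
     (if odd n then ((-1) ^+ bits_of s j)%:C else 1) *+ (s == t).
    by case: (odd n); rewrite mxE // rmorphXn /= rmorphN1.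
  have -> : n`!%:R^-1 = (n`!%:R^-1)%:C :> R[i] by rewrite fmorphV rmorph_nat.
  have -> : (-1) ^+ n./2 = ((-1) ^+ n./2)%:C :> R[i] by rewrite rmorphXn /= rmorphN1.
  rewrite -rmorphXn /=.
  move: (n`!%:R^-1 : R) ((-1) ^+ n./2) (y ^+ n) ((-1) ^+ bits_of s j : R) => f u v e.
  case: (s == t); case on: (odd n); rewrite /= ?mulr1n ?mulr0n;
    by apply/eqP; rewrite eq_complex /=; apply/andP; split; apply/eqP; ring.
have hRe : (fun n => complex.Re ((n`!%:R^-1 *: (('i%C * y%:C) *: pauliZ R j) ^+ n) s t)) =
  (s == t)%:R *: cos_coeff y by apply/funext => n; rewrite hterm.
have hIm : (fun n => complex.Im ((n`!%:R^-1 *: (('i%C * y%:C) *: pauliZ R j) ^+ n) s t)) =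
  ((-1) ^+ bits_of s j *+ (s == t)) *: sin_coeff y
  by apply/funext => n; rewrite hterm.
cbv zeta; rewrite hRe hIm !lim_seriesZ;
  [|exact: is_cvg_series_sin_coeff|exact: is_cvg_series_cos_coeff].
rewrite -![_ *: limn _]/(_ * _).
rewrite !mxE cos.unlock sin.unlock; case: (s == t); last first.
  by rewrite !mulr0n !mul0r !mulr0 addr0.
rewrite !mulr1n mul1r; apply/eqP; rewrite eq_complex /=.
by case: (bits_of s j); rewrite /=; apply/andP; split; apply/eqP; ring.
Qed.

Definition middle_mx j : op :=
  gate_mx R (GHad j) * (gate_mx R (GPhase j) * (gate_mx R (GPhase j) *
   (gate_mx R (GPhase j) * (gate_mx R (GPhase j) * gate_mx R (GHad j))))).

(** Four phases make a rotation by pi/2, which is i Z, and (X + Z) Z (X + Z) = 2 X because X and Z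
    anticommute. *)
Lemma middle_mxE j : middle_mx j = 'i%C *: pauliX R j.
Proof.
have hT : gate_mx R (GPhase j) = rotZ j (pi / 8) by rewrite /= exp_pauliZ.
have h4 A : gate_mx R (GPhase j) * (gate_mx R (GPhase j) *
   (gate_mx R (GPhase j) * (gate_mx R (GPhase j) * A))) = ('i%C *: pauliZ R j) * A.
  rewrite !mulrA hT !rotZM (_ : _ + _ + _ + _ = pi / 2); last by field.
  by rewrite /rotZ cos_pihalf sin_pihalf scale0r add0r mulr1.
have h2 : (Num.sqrt 2)^-1%:C * (Num.sqrt 2)^-1%:C * 2 = 1 :> R[i].
  rewrite -(rmorph_nat (real_complex R) 2) -!rmorphM /= -invfM -expr2 sqr_sqrtr //.
  by rewrite mulVf ?pnatr_eq0.
have hXZ : (pauliX R j + pauliZ R j) *m (pauliZ R j *m (pauliX R j + pauliZ R j)) =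
   2 *: pauliX R j.
  have -> : pauliZ R j *m (pauliX R j + pauliZ R j) = - (pauliX R j *m pauliZ R j) + 1%:M.
    by rewrite mulmxDr; congr (_ + _); [exact: pauliZX|exact: pauliZ2].
  rewrite mulmxDr mulmx1 mulmxN mulmxA mulmxDl.
  have -> : pauliX R j *m pauliX R j = 1%:M by exact: pauliX2.
  have -> : pauliZ R j *m pauliX R j = - (pauliX R j *m pauliZ R j) by exact: pauliZX.
  rewrite mulmxDl mul1mx mulNmx -mulmxA.
  have -> : pauliZ R j *m pauliZ R j = 1%:M by exact: pauliZ2.
  by rewrite mulmx1 opprD opprK [pauliX R j + _]addrC addrACA addNr add0r -mulr2n scaler_nat.
rewrite /middle_mx h4 /=.
rewrite -[LHS]/(_ *: (_ + _) *m ((_ *: _) *m (_ *: (_ + _)))).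
rewrite -!scalemxAl -!scalemxAr hXZ !scalerA; congr (_ *: _).
by rewrite mulrCA -mulrA h2 mulr1.
Qed.

Lemma xorb2K b c : xorb2 (xorb2 b c) c = b.
Proof. by apply/ffunP => i; rewrite !ffunE addbK. Qed.

Lemma flip_xorb2 j b : flip j b = xorb2 b [ffun i => i == j].
Proof. by apply/ffunP => i; rewrite !ffunE. Qed.

(** * Conjugating X by a CNot circuit *)

Section Conjugation.
Variable gs : seq (option (cnot w)).

Definition ogate (g : option (cnot w)) : op := oapp (@cnot_mx R w) 1 g.
Definition oact (g : option (cnot w)) : bits w -> bits w := oapp cnot_act id g.

Lemma ogate_ket g b : ogate g *m ket b = ket (oact g b).
Proof. by case: g => [g|] /=; rewrite ?cnot_ket ?mul1mx. Qed.

Lemma ogateK g : ogate g * ogate g = 1.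
Proof. by case: g => [g|] /=; rewrite ?cnot_mxK ?mulr1. Qed.

Lemma adjoint_ogate g : adjoint (ogate g) = ogate g.
Proof. by case: g => [g|] /=; rewrite ?adjoint_cnot ?adjoint1. Qed.

(** The first factor of a product acts last on a ket. Hence [bwd], over the reversed list, is the
    operator that runs the circuit in its listed order, and [fwd] is its inverse. [None] stands for
    an omitted gate. *)
Definition fwd : op := \prod_(g <- gs) ogate g.
Definition bwd : op := \prod_(g <- rev gs) ogate g.
Definition act b := foldl (fun c g => oact g c) b gs.

Lemma bwd_ket b : bwd *m ket b = ket (act b).
Proof.
rewrite /bwd /act; elim/last_ind: gs => [|s g IH] in b *; first by rewrite big_nil mul1mx.
by rewrite rev_rcons big_cons -mulmxA IH ogate_ket -cats1 foldl_cat.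
Qed.

Lemma bwd_fwd : bwd * fwd = 1.
Proof.
rewrite /bwd /fwd; elim: gs => [|g s IH]; first by rewrite !big_nil mulr1.
rewrite rev_cons -cats1 big_cat big_seq1 big_cons /=.
by rewrite mulrA -[_ * ogate g * ogate g]mulrA ogateK mulr1.
Qed.

Lemma adjoint_fwd : adjoint fwd = bwd.
Proof.
rewrite /bwd /fwd; elim: gs => [|g s IH]; first by rewrite !big_nil adjoint1.
by rewrite rev_cons -cats1 big_cat big_seq1 big_cons adjointM IH adjoint_ogate.
Qed.

Lemma adjoint_bwd : adjoint bwd = fwd.
Proof. by rewrite -adjoint_fwd /adjoint trmxCK. Qed.

Lemma actD b c : act (xorb2 b c) = xorb2 (act b) (act c).
Proof.
rewrite /act; elim: gs b c => //= g s IH b c; rewrite -IH.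
by case: g => [g|] //=; rewrite cnot_actD.
Qed.

Lemma conj_pauliX_ket j b :
  (bwd * pauliX R j * fwd) *m ket b = ket (xorb2 b (act [ffun i => i == j])).
Proof.
have [c hc] : exists c, fwd *m ket b = ket c.
  rewrite /fwd; elim: gs => [|g s [c hc]].
    by exists b; rewrite big_nil mul1mx.
  by exists (oact g c); rewrite big_cons -mulmxA hc ogate_ket.
have hb : act c = b.
  by apply: ket_inj; rewrite -bwd_ket -hc mulmxA (bwd_fwd : bwd *m fwd = _) mul1mx.
by rewrite -!mulmxA hc pauliX_ket bwd_ket flip_xorb2 actD hb.
Qed.

(** The conjugated X translates basis states by [e]. Between the two occurrences of Z the bit [j]
    changes by [e j], so the signs multiply to (-1)^(e_j) on every basis state, and the matrix is
    scalar. *)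
Lemma bias_conj j (V := bwd * (middle_mx j * fwd)) :
  \tr (V * pauliZ R j * adjoint V * pauliZ R j) =
  (-1) ^+ act [ffun i => i == j] j * (2 ^ w)%:R.
Proof.
set B := bwd * pauliX R j * fwd; set e := act _.
have hV : V = 'i%C *: B.
  rewrite /V middle_mxE /B -[LHS]/(bwd *m (('i%C *: pauliX R j) *m fwd)).
  by rewrite -scalemxAl -scalemxAr mulmxA.
have cB b : B *m ket b = ket (xorb2 b e) by apply: conj_pauliX_ket.
have hB : adjoint B = B.
  by rewrite /B !adjointM adjoint_fwd adjoint_bwd adjoint_pauliX mulrA.
have -> : V * pauliZ R j * adjoint V * pauliZ R j = (-1) ^+ e j *: 1%:M.
  rewrite hV adjointZ hB -[LHS]/(((('i%C *: B) *m pauliZ R j) *m (_ *: B)) *m pauliZ R j).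
  rewrite -!scalemxAl -!scalemxAr -!scalemxAl scalerA.
  (* The factor i meets its conjugate. *)
  rewrite [_ * _](_ : _ = 1); last first.
    by apply/eqP; rewrite eq_complex /=; apply/andP; split; apply/eqP; ring.
  rewrite scale1r; apply: op_ext => b.
  rewrite -(mulmxA _ _ (ket b)) pauliZ_ket -(mulmxA _ B) -scalemxAr cB.
  rewrite -scalemxAr -mulmxA pauliZ_ket -scalemxAr cB xorb2K scalerA ffunE -scalemxAl mul1mx.
  congr (_ *: _).
  by case: (b j); case: (e j); rewrite /= ?mulr1 ?mul1r ?mulrN1 ?opprK.
by rewrite mxtraceZ mxtrace1.
Qed.

End Conjugation.
End Quantum.

(** * From CNot circuits to DQC1 circuits *)

Definition to_triple n w (t : option ('I_n.+1 * bool) * cnot w) :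
    'I_n.+1 * gate w * gate w :=
  match t.1 with
  | Some (i, true) => (i, @GId w, GCNot t.2)
  | Some (i, false) => (i, GCNot t.2, @GId w)
  | None => (ord0, GCNot t.2, GCNot t.2)
  end.

Definition middle_triples n w (j : 'I_w) : seq ('I_n.+1 * gate w * gate w) :=
  [seq (ord0, g, g) |
   g <- [:: GHad j; GPhase j; GPhase j; GPhase j; GPhase j; GHad j]].

Definition to_dqc1 n : cnot_circuit n -> dqc1_circuit n :=
  match n with
  | 0 => fun D => DQC1Circuit (cnot_width_gt0 D) [::]
  | n'.+1 => fun D => DQC1Circuit (cnot_width_gt0 D)
      (map (@to_triple n' _) (rev (cnot_gates D)) ++
       middle_triples n' (Ordinal (cnot_width_gt0 D)) ++
       map (@to_triple n' _) (cnot_gates D))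
  end.

Definition raw_gate n w (t : option ('I_n * bool) * cnot w) : rawgate :=
  (omap (fun c => (nat_of_ord c.1, c.2)) t.1,
   (nat_of_ord (val t.2).1, nat_of_ord (val t.2).2)).

Lemma describe_raw_gate n (D : cnot_circuit n) : describe_cnot_circuit D =
  describe_nat (cnot_width D) ++ flatten (map gate_in (map (@raw_gate n _) (cnot_gates D))).
Proof.
rewrite /describe_cnot_circuit -map_comp; congr (_ ++ flatten _); apply: eq_map.
by case=> [[[i b]|] c].
Qed.

Lemma describe_triple_raw n w (t : option ('I_n.+1 * bool) * cnot w) :
  describe_triple (to_triple t) = gate_out (raw_gate t).
Proof.
by case: t => [[[i []]|] c]; rewrite /gate_out /= /describe_cnot /= -?catA ?cats1.
Qed.

Lemma describe_to_dqc1 n (D : cnot_circuit n.+1) : describe_dqc1 (to_dqc1 D) =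
  describe_nat (cnot_width D) ++
  flatten (map gate_out (rev (map (@raw_gate n.+1 _) (cnot_gates D)))) ++ middle ++
  flatten (map gate_out (map (@raw_gate n.+1 _) (cnot_gates D))).
Proof.
have e (s : seq (option ('I_n.+1 * bool) * cnot (cnot_width D))) :
    [seq describe_triple t | t <- [seq to_triple t | t <- s]] =
    [seq gate_out t | t <- [seq raw_gate t | t <- s]].
  by rewrite -!map_comp; apply: eq_map => t; apply: describe_triple_raw.
rewrite /describe_dqc1 [dqc1_gates _]/(_ ++ _) !map_cat !flatten_cat.
by rewrite -[rev (map _ _)]map_rev -!e.
Qed.

Section Semantics.
Variables (R : realType) (n : nat) (D : cnot_circuit n.+1) (x : n.+1.-tuple bool).
Local Notation w := (cnot_width D).
Local Notation j0 := (Ordinal (cnot_width_gt0 D)).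

Definition applied : seq (option (cnot w)) :=
  [seq if control_on x t.1 then Some t.2 else None | t <- cnot_gates D].

Lemma gate_mx_triple t : (let: (i, A, B) := to_triple t in
  gate_mx R (if tnth x i then B else A)) =
  ogate R (if control_on x t.1 then Some t.2 else None) :> op R w.
Proof. by case: t => [[[i []]|] c] /=; case: (tnth x _). Qed.

Lemma unitary_to_dqc1 : dqc1_unitary R (to_dqc1 D) x =
  (bwd R applied * (middle_mx R j0 * fwd R applied))%R.
Proof.
rewrite /dqc1_unitary /fwd /bwd /applied -map_rev big_cat /= !big_cons !big_map !if_same.
rewrite /middle_mx -!mulrA; congr (_ * (_ * (_ * (_ * (_ * (_ * (_ * _)))))))%R;
  by apply: eq_bigr => t _; apply: gate_mx_triple.
Qed.

Lemma bias_to_dqc1 : output_bias R (to_dqc1 D) x = ((-1) ^+ act applied (cnot_start D) j0)%R.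
Proof.
rewrite /output_bias unitary_to_dqc1 (bias_conj R applied j0) mulfK //.
Qed.

Lemma cnot_finalE : cnot_final R D x = ket R (act applied (cnot_start D)).
Proof.
rewrite /cnot_final /act /applied; elim: (cnot_gates D) (cnot_start D) => //= t s IH b.
by rewrite -IH; case: ifP => //= _; rewrite cnot_ket.
Qed.

End Semantics.

Local Open Scope classical_set_scope.

Theorem lemma2 (R : realType) : ParityL R `<=` BQ1P R.
Proof.
move=> L [D [[M [hM hout]] hL]].
(* The bias is exactly 1 or -1, so the constant 1 serves as [q]. *)
exists (fun n => to_dqc1 (D n)), (fun=> 1%R); split=> //.
- exists (compose M rewriter); apply: compose_logspace hM hout _ => -[|n].
    rewrite /describe_dqc1 cats0; apply: rewriter_run_empty.
    exact: erefl.
  rewrite describe_to_dqc1; apply: rewriter_run.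
  exact: describe_raw_gate.
- by exists 1%:P%R => n; rewrite hornerC.
- move=> x x0; have := hL x.
  case: x x0 => // a x _ hx /=.
  rewrite bias_to_dqc1 divr1.
  set e := act _ _ _ in hx *.
  have -> : L (a :: x) <-> e = false.
    rewrite hx cnot_finalE; split=> [[b [/ket_inj <-]]//|h].
    by eexists; split; [exact: erefl|].
  by case: (e); split=> // h; case: h.
Qed.
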